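(* Every locally countable Borel partial order of height two has a Borel embedding into Turing reducibility.
   Context: A Borel partial order is a partial order $(P,\leq_P)$ with $P$ a Borel subset of $2^\omega$ and $\leq_P$ a Borel subset of $2^\omega\times 2^\omega$. It is locally countable if every element has at most countably many strict predecessors, and has height $n$ if its longest chain has length exactly $n$. A Borel embedding of $P$ into Turing reducibility is a Borel measurable function $f\colon P\to 2^\omega$ such that for all $x,y\in P$, $x\leq_P y \iff f(x)\leq_T f(y)$. *)

(* Defs.v *)
From Stdlib Require Import List.
Import ListNotations.

Definition cantor := nat -> bool.

Definition countable_set {T : Type} (S : T -> Prop) : Prop :=
  exists e : nat -> option T, forall y, S y -> exists n, e n = Some y.

Inductive sigma_gen {T : Type} (G : (T -> Prop) -> Prop) : (T -> Prop) -> Prop :=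
| sg_gen : forall A, G A -> sigma_gen G A
| sg_compl : forall A, sigma_gen G A -> sigma_gen G (fun x => ~ A x)
| sg_cunion : forall A : nat -> T -> Prop,
    (forall n, sigma_gen G (A n)) -> sigma_gen G (fun x => exists n, A n x)
| sg_ext : forall A B, sigma_gen G A -> (forall x, A x <-> B x) -> sigma_gen G B.

(** Subbasic clopen sets of 2^omega: {x | x n = b}.  They generate the
   topology, and 2^omega is second countable, so they generate the Borel sets. *)
Definition cantor_subbasic (A : cantor -> Prop) : Prop :=
  exists n b, forall x, A x <-> x n = b.

Definition borel (A : cantor -> Prop) : Prop := sigma_gen cantor_subbasic A.

Definition cantor2_subbasic (A : cantor * cantor -> Prop) : Prop :=
  exists n b, (forall p, A p <-> fst p n = b) \/ (forall p, A p <-> snd p n = b).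

Definition borel2 (A : cantor * cantor -> Prop) : Prop := sigma_gen cantor2_subbasic A.

Definition borel_measurable_on (P : cantor -> Prop) (f : cantor -> cantor) : Prop :=
  forall B, borel B -> borel (fun x => P x /\ B (f x)).

Inductive code : Type :=
| CZero : code
| CSucc : code
| CProj : nat -> code
| COracle : code
| CComp : code -> list code -> code
| CPrec : code -> code -> code
| CMu : code -> code.

Inductive eval (o : cantor) : code -> list nat -> nat -> Prop :=
| ev_zero : forall args, eval o CZero args 0
| ev_succ : forall n args, eval o CSucc (n :: args) (S n)
| ev_proj : forall i args, i < length args -> eval o (CProj i) args (nth i args 0)
| ev_oracle : forall n args, eval o COracle (n :: args) (if o n then 1 else 0)
| ev_comp : forall g hs args vs r,
    Forall2 (fun h v => eval o h args v) hs vs ->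
    eval o g vs r -> eval o (CComp g hs) args r
| ev_prec0 : forall g h args r, eval o g args r -> eval o (CPrec g h) (0 :: args) r
| ev_precS : forall g h n args r r',
    eval o (CPrec g h) (n :: args) r ->
    eval o h (n :: r :: args) r' ->
    eval o (CPrec g h) (S n :: args) r'
| ev_mu : forall g args n,
    eval o g (n :: args) 0 ->
    (forall m, m < n -> exists v, v <> 0 /\ eval o g (m :: args) v) ->
    eval o (CMu g) args n.

Definition turing_le (x y : cantor) : Prop :=
  exists c : code, forall n, eval y c [n] (if x n then 1 else 0).

Definition strict_of (le : cantor * cantor -> Prop) (x y : cantor) : Prop :=
  le (x, y) /\ x <> y.

Definition is_borel_partial_order (P : cantor -> Prop) (le : cantor * cantor -> Prop) : Prop :=
  borel P /\ borel2 le /\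
  (forall x y, le (x, y) -> P x /\ P y) /\
  (forall x, P x -> le (x, x)) /\
  (forall x y, le (x, y) -> le (y, x) -> x = y) /\
  (forall x y z, le (x, y) -> le (y, z) -> le (x, z)).

Definition locally_countable (P : cantor -> Prop) (le : cantor * cantor -> Prop) : Prop :=
  forall x, P x -> countable_set (fun y => strict_of le y x).

Definition height_two (le : cantor * cantor -> Prop) : Prop :=
  (exists x y, strict_of le x y) /\
  ~ (exists x y z, strict_of le x y /\ strict_of le y z).

Definition borel_embedding_turing (P : cantor -> Prop) (le : cantor * cantor -> Prop)
  (f : cantor -> cantor) : Prop :=
  borel_measurable_on P f /\
  forall x y, P x -> P y -> (le (x, y) <-> turing_le (f x) (f y)).

(* Main.v *)
From Stdlib Require Import Arith Lia List Bool Cantor.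
From Stdlib Require Import Classical ClassicalEpsilon FunctionalExtensionality.
Require Import Defs.
Import ListNotations.

(** Let [G x], for [x] in Cantor space, run through a perfect set such that no member is the
    value at finitely many other members of any functional from a fixed countable family of
    partial continuous functionals. By forcing with finite strings that copy [G x_0],
    [G x_1], ... into their columns one finds an upper bound of the [G x_i] that computes no
    other member of the perfect set: if a computation never leaves the perfect set, never
    becomes partial, and avoids [G x_0, ..., G x_(k-1)], then the greedy search for
    convergent values is a continuous functional taking [G x_0, ..., G x_(k-1)] to a new
    member of the perfect set. Adding this search to the family replaces any effectivity
    argument.

    A minimal [y] is sent to [G y], and any other [y] to the upper bound of the [G z] with
    [z <= y]. Since the order has height two, [f y <= f z] forces [G y <= f z], hence
    [y <= z]. The map is Borel because the predecessors of [y] can be listed by Borel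
    functions (Lusin-Novikov). To see this, represent the order as the projection of a
    closed set. The tree of finite approximations to a perfect set inside a section is
    well-founded, so its rank bounds, uniformly in [y], the length of the
    Cantor-Bendixson analysis of the sections, and each step of this analysis isolates
    points in a Borel way. *)

(** * Finite strings and their extensions *)

Definition agree {A : Type} (n : nat) (x y : nat -> A) : Prop :=
  forall i, i < n -> x i = y i.

Definition on {A : Type} (s : list A) (x : nat -> A) : Prop :=
  forall i a, nth_error s i = Some a -> x i = a.

Definition sub {A : Type} (s t : list A) : Prop :=
  forall i a, nth_error s i = Some a -> nth_error t i = Some a.

Definition pre {A : Type} (x : nat -> A) (n : nat) : list A := map x (seq 0 n).

Lemma length_pre {A : Type} (x : nat -> A) n : length (pre x n) = n.
Proof. unfold pre. now rewrite length_map, length_seq. Qed.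

Lemma nth_error_pre {A : Type} (x : nat -> A) n i :
  i < n -> nth_error (pre x n) i = Some (x i).
Proof.
  intro Hi. unfold pre. rewrite nth_error_map, nth_error_seq.
  destruct (Nat.ltb_spec i n); [reflexivity | lia].
Qed.

Lemma nth_error_length {A : Type} (s : list A) i a :
  nth_error s i = Some a -> i < length s.
Proof. intro H. apply nth_error_Some. congruence. Qed.

Lemma nth_error_pre_inv {A : Type} (x : nat -> A) n i a :
  nth_error (pre x n) i = Some a -> i < n /\ a = x i.
Proof.
  intro H. pose proof (nth_error_length _ _ _ H) as Hi. rewrite length_pre in Hi.
  rewrite nth_error_pre in H by exact Hi. split; congruence.
Qed.

Lemma nth_error_ex {A : Type} (s : list A) i :
  i < length s -> exists a, nth_error s i = Some a.
Proof.
  intro H. destruct (nth_error s i) as [a|] eqn:E; [eauto|].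
  apply nth_error_None in E. lia.
Qed.

Lemma on_pre {A : Type} (x : nat -> A) n : on (pre x n) x.
Proof. intros i a H. now apply nth_error_pre_inv in H. Qed.

Lemma on_pre_agree {A : Type} (x y : nat -> A) n : on (pre x n) y <-> agree n x y.
Proof.
  split.
  - intros H i Hi. symmetry. apply H. now apply nth_error_pre.
  - intros H i a Hi. apply nth_error_pre_inv in Hi as [Hi ->]. symmetry. now apply H.
Qed.

Lemma on_sub_pre {A : Type} (s : list A) x n : on s x -> length s <= n -> sub s (pre x n).
Proof.
  intros H Hn i a Hi. rewrite nth_error_pre.
  - now rewrite (H _ _ Hi).
  - apply nth_error_length in Hi. lia.
Qed.

Lemma on_on_agree {A : Type} (s : list A) x y : on s x -> on s y -> agree (length s) x y.
Proof.
  intros Hx Hy i Hi. destruct (nth_error_ex s i Hi) as [a Ha].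
  now rewrite (Hx _ _ Ha), (Hy _ _ Ha).
Qed.

Lemma on_default {A : Type} (s : list A) d : on s (fun i => nth i s d).
Proof. intros i a H. now apply nth_error_nth. Qed.

Lemma sub_on {A : Type} (s t : list A) x : sub s t -> on t x -> on s x.
Proof. intros Hs Ht i a H. apply Ht, Hs, H. Qed.

Lemma sub_refl {A : Type} (s : list A) : sub s s.
Proof. intros i a H; exact H. Qed.

Lemma sub_trans {A : Type} (s t u : list A) : sub s t -> sub t u -> sub s u.
Proof. intros H H' i a Hi. auto. Qed.

Lemma sub_app {A : Type} (s t : list A) : sub s (s ++ t).
Proof.
  intros i a H. rewrite nth_error_app1; [exact H|]. now apply nth_error_length in H.
Qed.

Lemma sub_length {A : Type} (s t : list A) : sub s t -> length s <= length t.
Proof.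
  intro H. destruct (length s) as [|n] eqn:E; [lia|].
  destruct (nth_error_ex s n) as [a Ha]; [lia|].
  apply H, nth_error_length in Ha. lia.
Qed.

Lemma sub_back {A : Type} (s t : list A) i a :
  sub s t -> i < length s -> nth_error t i = Some a -> nth_error s i = Some a.
Proof.
  intros H Hi Ha. destruct (nth_error_ex s i Hi) as [b Hb].
  rewrite Hb. rewrite (H _ _ Hb) in Ha. exact Ha.
Qed.

Lemma sub_chain {A : Type} (s : nat -> list A) :
  (forall n, sub (s n) (s (S n))) -> forall m n, m <= n -> sub (s m) (s n).
Proof.
  intros H m n Hmn. induction Hmn; [apply sub_refl|].
  eapply sub_trans; eauto.
Qed.

(** Position [k] is read from [s (S k)], the first member sure to be long enough; coherence makes
    the other members agree. *)
Lemma chain_limit {A : Type} (d : A) (s : nat -> list A) :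
  (forall n, sub (s n) (s (S n))) -> (forall n, n <= length (s n)) ->
  forall n, on (s n) (fun k => nth k (s (S k)) d).
Proof.
  intros Hs Hl n i a Hi. apply nth_error_nth.
  destruct (Nat.le_ge_cases n (S i)) as [H|H].
  - now apply (sub_chain s Hs n (S i) H).
  - eapply sub_back; [apply (sub_chain s Hs (S i) n H)| |exact Hi].
    specialize (Hl (S i)). lia.
Qed.

(** * Countable types *)

Definition enumerable (A : Type) : Prop :=
  exists e : nat -> A, forall a, exists n, e n = a.

Lemma enumerable_nat : enumerable nat.
Proof. exists (fun n => n). eauto. Qed.

Lemma enumerable_bool : enumerable bool.
Proof. exists (Nat.eqb 0). intros []; [exists 0 | exists 1]; reflexivity. Qed.

Lemma enumerable_prod A B : enumerable A -> enumerable B -> enumerable (A * B).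
Proof.
  intros [e He] [f Hf].
  exists (fun n => (e (fst (Cantor.of_nat n)), f (snd (Cantor.of_nat n)))).
  intros [a b]. destruct (He a) as [i Hi], (Hf b) as [j Hj].
  exists (Cantor.to_nat (i, j)). rewrite Cantor.cancel_of_to. simpl. congruence.
Qed.

#[local] Opaque Cantor.of_nat Cantor.to_nat.

Fixpoint decode_tuple {A : Type} (e : nat -> A) (k n : nat) : list A :=
  match k with
  | 0 => []
  | S k => e (fst (Cantor.of_nat n)) :: decode_tuple e k (snd (Cantor.of_nat n))
  end.

Definition decode_list {A : Type} (e : nat -> A) (n : nat) : list A :=
  decode_tuple e (fst (Cantor.of_nat n)) (snd (Cantor.of_nat n)).

Lemma decode_list_onto {A : Type} (e : nat -> A) (l : list A) :
  Forall (fun a => exists n, e n = a) l -> exists n, decode_list e n = l.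
Proof.
  intro H. assert (Ht : exists n, decode_tuple e (length l) n = l).
  { induction H as [|a l [i Hi] _ [j Hj]]; [now exists 0|].
    exists (Cantor.to_nat (i, j)). simpl. rewrite Cantor.cancel_of_to. simpl. congruence. }
  destruct Ht as [n Hn]. exists (Cantor.to_nat (length l, n)).
  unfold decode_list. now rewrite Cantor.cancel_of_to.
Qed.

Lemma enumerable_list A : enumerable A -> enumerable (list A).
Proof.
  intros [e He]. exists (decode_list e). intro l. apply decode_list_onto.
  apply Forall_forall. auto.
Qed.

(** [fuel] bounds the nesting depth, as the components of a pair are not structurally smaller than
    its code. *)
Fixpoint decode_code (fuel n : nat) : code :=
  match fuel with
  | 0 => CZero
  | S k =>
    let (tag, m) := Cantor.of_nat n in
    let (a, b) := Cantor.of_nat m in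
    match tag with
    | 0 => CZero
    | 1 => CSucc
    | 2 => CProj m
    | 3 => COracle
    | 4 => CComp (decode_code k a) (decode_list (decode_code k) b)
    | 5 => CPrec (decode_code k a) (decode_code k b)
    | _ => CMu (decode_code k m)
    end
  end.

Fixpoint code_nested_ind (Q : code -> Prop)
  (h0 : Q CZero) (h1 : Q CSucc) (h2 : forall i, Q (CProj i)) (h3 : Q COracle)
  (h4 : forall g hs, Q g -> Forall Q hs -> Q (CComp g hs))
  (h5 : forall g h, Q g -> Q h -> Q (CPrec g h))
  (h6 : forall g, Q g -> Q (CMu g)) (c : code) : Q c :=
  let rec := code_nested_ind Q h0 h1 h2 h3 h4 h5 h6 in
  match c with
  | CZero => h0
  | CSucc => h1
  | CProj i => h2 i
  | COracle => h3
  | CComp g hs =>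
    h4 g hs (rec g)
      ((fix all (l : list code) : Forall Q l :=
          match l with
          | [] => Forall_nil Q
          | c :: l => Forall_cons c (rec c) (all l)
          end) hs)
  | CPrec g h => h5 g h (rec g) (rec h)
  | CMu g => h6 g (rec g)
  end.

Lemma decode_code_onto (c : code) :
  exists k, forall k', k <= k' -> exists n, decode_code k' n = c.
Proof.
  induction c as [| |i| |g hs [k1 H1] Hhs|g h [k1 H1] [k2 H2]|g [k1 H1]] using code_nested_ind.
  - exists 0. intros [|k] _; [now exists 0|]. exists (Cantor.to_nat (0, 0)).
    simpl. rewrite Cantor.cancel_of_to.
    now destruct (Cantor.of_nat 0).
  - exists 1. intros [|k] Hk; [lia|]. exists (Cantor.to_nat (1, 0)).
    simpl. rewrite Cantor.cancel_of_to.
    now destruct (Cantor.of_nat 0).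
  - exists 1. intros [|k] Hk; [lia|]. exists (Cantor.to_nat (2, i)).
    simpl. rewrite Cantor.cancel_of_to.
    now destruct (Cantor.of_nat i).
  - exists 1. intros [|k] Hk; [lia|]. exists (Cantor.to_nat (3, 0)).
    simpl. rewrite Cantor.cancel_of_to.
    now destruct (Cantor.of_nat 0).
  - assert (Hl : exists k, forall k', k <= k' ->
        Forall (fun c => exists n, decode_code k' n = c) hs).
    { induction Hhs as [|c l [k2 H2] _ [k3 H3]]; [exists 0; constructor|].
      exists (max k2 k3). intros k' Hk'. constructor; [apply H2|apply H3]; lia. }
    destruct Hl as [k2 H2]. exists (S (max k1 k2)). intros [|k] Hk; [lia|].
    destruct (H1 k) as [a Ha]; [lia|].
    destruct (decode_list_onto (decode_code k) hs) as [b Hb]; [apply H2; lia|].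
    exists (Cantor.to_nat (4, Cantor.to_nat (a, b))).
    simpl. rewrite !Cantor.cancel_of_to. congruence.
  - exists (S (max k1 k2)). intros [|k] Hk; [lia|].
    destruct (H1 k) as [a Ha]; [lia|]. destruct (H2 k) as [b Hb]; [lia|].
    exists (Cantor.to_nat (5, Cantor.to_nat (a, b))).
    simpl. rewrite !Cantor.cancel_of_to. congruence.
  - exists (S k1). intros [|k] Hk; [lia|]. destruct (H1 k) as [a Ha]; [lia|].
    exists (Cantor.to_nat (6, a)).
    simpl. rewrite Cantor.cancel_of_to.
    destruct (Cantor.of_nat a). congruence.
Qed.

Lemma enumerable_code : enumerable code.
Proof.
  exists (fun n => decode_code (fst (Cantor.of_nat n)) (snd (Cantor.of_nat n))).
  intro c. destruct (decode_code_onto c) as [k Hk].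
  destruct (Hk k (le_n k)) as [n Hn]. exists (Cantor.to_nat (k, n)).
  now rewrite Cantor.cancel_of_to.
Qed.

Create HintDb enum.
#[local] Hint Resolve enumerable_nat enumerable_bool enumerable_prod enumerable_list
  enumerable_code : enum.

(** * Borel sets and Borel functions *)

Lemma borel_ext (A B : cantor -> Prop) : borel A -> (forall x, A x <-> B x) -> borel B.
Proof. apply sg_ext. Qed.

Lemma borel_not (A : cantor -> Prop) : borel A -> borel (fun x => ~ A x).
Proof. apply sg_compl. Qed.

Lemma borel_ex {I : Type} (A : I -> cantor -> Prop) :
  enumerable I -> (forall i, borel (A i)) -> borel (fun x => exists i, A i x).
Proof.
  intros [e He] H. apply borel_ext with (fun x => exists n, A (e n) x).
  - apply (sg_cunion _ (fun n => A (e n))). intro n. apply H.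
  - intro x. split; [intros [n Hn]; eauto|].
    intros [i Hi]. destruct (He i) as [n <-]. eauto.
Qed.

Lemma borel_all {I : Type} (A : I -> cantor -> Prop) :
  enumerable I -> (forall i, borel (A i)) -> borel (fun x => forall i, A i x).
Proof.
  intros HI H. apply borel_ext with (fun x => ~ exists i, ~ A i x).
  - apply borel_not, borel_ex; [exact HI|]. intro i. apply borel_not, H.
  - intro x. split.
    + intros Hx i. apply NNPP. eauto.
    + intros Hx [i Hi]. auto.
Qed.

Lemma borel_or (A B : cantor -> Prop) : borel A -> borel B -> borel (fun x => A x \/ B x).
Proof.
  intros HA HB. apply borel_ext with (fun x => exists b : bool, if b then A x else B x).
  - apply (borel_ex (fun (b : bool) x => if b then A x else B x)); [auto with enum|].
    intros []; assumption.
  - intro x. split; [intros [[] H]; auto|].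
    intros [H|H]; [now exists true | now exists false].
Qed.

Lemma borel_and (A B : cantor -> Prop) : borel A -> borel B -> borel (fun x => A x /\ B x).
Proof.
  intros HA HB. apply borel_ext with (fun x => ~ (~ A x \/ ~ B x)).
  - now apply borel_not, borel_or; apply borel_not.
  - intro x. tauto.
Qed.

Lemma borel_imp (A B : cantor -> Prop) : borel A -> borel B -> borel (fun x => A x -> B x).
Proof.
  intros HA HB. apply borel_ext with (fun x => ~ A x \/ B x).
  - now apply borel_or; [apply borel_not|].
  - intro x. tauto.
Qed.

Lemma borel_bit n b : borel (fun x => x n = b).
Proof. apply sg_gen. exists n, b. reflexivity. Qed.

Lemma borel_const (Q : Prop) : borel (fun _ => Q).
Proof.
  destruct (classic Q) as [H|H].
  - apply borel_ext with (fun x => x 0 = true \/ ~ x 0 = true).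
    + apply borel_or; [|apply borel_not]; apply borel_bit.
    + intro x. tauto.
  - apply borel_ext with (fun x => x 0 = true /\ ~ x 0 = true).
    + apply borel_and; [|apply borel_not]; apply borel_bit.
    + intro x. tauto.
Qed.

Definition borel_fun (h : cantor -> cantor) : Prop :=
  forall n, borel (fun x => h x n = true).

Lemma borel_fun_bit h n b : borel_fun h -> borel (fun x => h x n = b).
Proof.
  intro H. destruct b; [apply H|].
  apply borel_ext with (fun x => ~ h x n = true); [apply borel_not, H|].
  intro x. apply not_true_iff_false.
Qed.

Lemma borel_fun_eq_bit h n b : borel_fun h -> borel (fun x => b = h x n).
Proof.
  intro H. apply borel_ext with (fun x => h x n = b); [now apply borel_fun_bit|].
  intro x. split; congruence.
Qed.

Lemma borel_fun_id : borel_fun (fun x => x).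
Proof. intro n. apply borel_bit. Qed.

Lemma borel_preimage (h : cantor -> cantor) (B : cantor -> Prop) :
  borel_fun h -> borel B -> borel (fun x => B (h x)).
Proof.
  intros Hh HB. induction HB as [A [n [b H]]|A _ IH|A _ IH|A B _ IH H].
  - apply borel_ext with (fun x => h x n = b); [now apply borel_fun_bit|].
    intro x. symmetry. apply H.
  - now apply borel_not.
  - apply (borel_ex (fun n x => A n (h x))); auto with enum.
  - apply borel_ext with (fun x => A (h x)); [exact IH|]. intro x. apply H.
Qed.

Lemma borel2_preimage (g h : cantor -> cantor) (B : cantor * cantor -> Prop) :
  borel_fun g -> borel_fun h -> borel2 B -> borel (fun x => B (g x, h x)).
Proof.
  intros Hg Hh HB. induction HB as [A [n [b [H|H]]]|A _ IH|A _ IH|A B _ IH H].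
  - apply borel_ext with (fun x => g x n = b); [now apply borel_fun_bit|].
    intro x. symmetry. apply H.
  - apply borel_ext with (fun x => h x n = b); [now apply borel_fun_bit|].
    intro x. symmetry. apply H.
  - now apply borel_not.
  - apply (borel_ex (fun n x => A n (g x, h x))); auto with enum.
  - apply borel_ext with (fun x => A (g x, h x)); [exact IH|]. intro x. apply H.
Qed.

Lemma borel_fun_comp g h : borel_fun g -> borel_fun h -> borel_fun (fun x => g (h x)).
Proof. intros Hg Hh n. now apply (borel_preimage h (fun x => g x n = true)). Qed.

Lemma borel_fun_if (Q : cantor -> Prop) g h :
  borel Q -> borel_fun g -> borel_fun h ->
  borel_fun (fun x => if excluded_middle_informative (Q x) then g x else h x).
Proof.
  intros HQ Hg Hh n.
  apply borel_ext with (fun x => (Q x /\ g x n = true) \/ (~ Q x /\ h x n = true)).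
  - apply borel_or; apply borel_and; auto using borel_not.
  - intro x. destruct (excluded_middle_informative (Q x)); tauto.
Qed.

Lemma borel_fun_asbool (Q : nat -> cantor -> Prop) :
  (forall n, borel (Q n)) ->
  borel_fun (fun x n => if excluded_middle_informative (Q n x) then true else false).
Proof.
  intros HQ n. apply borel_ext with (Q n); [apply HQ|].
  intro x. destruct (excluded_middle_informative (Q n x)); split; easy.
Qed.

Lemma borel_eq_fun g h : borel_fun g -> borel_fun h -> borel (fun x => g x = h x).
Proof.
  intros Hg Hh.
  apply borel_ext with (fun x => forall n : nat, exists b : bool, g x n = b /\ h x n = b).
  - apply borel_all; [auto with enum|]. intro n. apply borel_ex; [auto with enum|].
    intro b. apply borel_and; now apply borel_fun_bit.
  - intro x. split.
    + intro H. apply functional_extensionality. intro n.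
      destruct (H n) as [b [-> ->]]. reflexivity.
    + intros -> n. eauto.
Qed.

Lemma borel_on (s : list bool) : borel (on s).
Proof.
  unfold on. apply borel_all; [auto with enum|]. intro i.
  apply borel_all; [auto with enum|]. intro a.
  apply borel_imp; [apply borel_const | apply borel_bit].
Qed.

Lemma borel_local (n : nat) (Q : cantor -> Prop) :
  (forall x y, agree n x y -> Q x -> Q y) -> borel Q.
Proof.
  intro H.
  apply borel_ext with (fun x => exists s, (length s = n /\ exists y, on s y /\ Q y) /\ on s x).
  - apply borel_ex; [auto with enum|]. intro s.
    apply borel_and; [apply borel_const | apply borel_on].
  - intro x. split.
    + intros [s [[Hs [y [Hy Qy]]] Hx]]. apply (H y); [|exact Qy].
      rewrite <- Hs. exact (on_on_agree s y x Hy Hx).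
    + intro Qx. exists (pre x n). rewrite length_pre. eauto using on_pre.
Qed.

Lemma borel_measurable_of_borel_fun (P : cantor -> Prop) f :
  borel P -> borel_fun f -> borel_measurable_on P f.
Proof. intros HP Hf B HB. apply borel_and; [exact HP|]. now apply borel_preimage. Qed.

(** * Analytic sets *)

(** Closedness in the product of two Cantor spaces and Baire space; projecting along Baire space
    gives the analytic sets. *)
Definition closed3 (K : cantor -> cantor -> (nat -> nat) -> Prop) : Prop :=
  forall x y z,
    (forall n, exists x' y' z', agree n x x' /\ agree n y y' /\ agree n z z' /\ K x' y' z') ->
    K x y z.

Definition analytic2 (A : cantor * cantor -> Prop) : Prop :=
  exists K, closed3 K /\ forall x y, A (x, y) <-> exists z, K x y z.

Lemma analytic2_ext (A B : cantor * cantor -> Prop) :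
  analytic2 A -> (forall p, A p <-> B p) -> analytic2 B.
Proof.
  intros [K [HK H]] E. exists K. split; [exact HK|]. intros x y. now rewrite <- E.
Qed.

Lemma analytic2_fst n (Q : bool -> Prop) : analytic2 (fun p => Q (fst p n)).
Proof.
  exists (fun x _ _ => Q (x n)). split.
  - intros x y z H. destruct (H (S n)) as [x' [y' [z' [Hx [_ [_ HQ]]]]]].
    rewrite (Hx n) by lia. exact HQ.
  - intros x y. simpl. split; [intro HQ; now exists (fun _ => 0) | now intros [_ HQ]].
Qed.

Lemma analytic2_snd n (Q : bool -> Prop) : analytic2 (fun p => Q (snd p n)).
Proof.
  exists (fun _ y _ => Q (y n)). split.
  - intros x y z H. destruct (H (S n)) as [x' [y' [z' [_ [Hy [_ HQ]]]]]].
    rewrite (Hy n) by lia. exact HQ.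
  - intros x y. simpl. split; [intro HQ; now exists (fun _ => 0) | now intros [_ HQ]].
Qed.

Lemma analytic2_ex (A : nat -> cantor * cantor -> Prop) :
  (forall n, analytic2 (A n)) -> analytic2 (fun p => exists n, A n p).
Proof.
  intro H. apply (choice _) in H as [K HK].
  exists (fun x y z => K (z 0) x y (fun k => z (S k))). split.
  - intros x y z H. apply HK. intro n.
    destruct (H (S n)) as [x' [y' [z' [Hx [Hy [Hz HQ]]]]]].
    exists x', y', (fun k => z' (S k)). rewrite (Hz 0) by lia.
    repeat split; try exact HQ; intros i Hi; [apply Hx|apply Hy|apply Hz]; lia.
  - intros x y. split.
    + intros [n Hn]. apply HK in Hn as [z Hz].
      now exists (fun k => match k with 0 => n | S k => z k end).
    + intros [z Hz]. exists (z 0). apply HK. eauto.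
Qed.

(** A single witness holds one witness for each [n], through the pairing function. *)
Lemma analytic2_all (A : nat -> cantor * cantor -> Prop) :
  (forall n, analytic2 (A n)) -> analytic2 (fun p => forall n, A n p).
Proof.
  intro H. apply (choice _) in H as [K HK].
  exists (fun x y z => forall n, K n x y (fun k => z (Cantor.to_nat (n, k)))). split.
  - intros x y z H n. apply HK. intro m.
    assert (Hb : exists N, m <= N /\ forall k, k < m -> Cantor.to_nat (n, k) < N).
    { clear. induction m as [|m [N [HN IH]]]; [now exists 0|].
      exists (max (S N) (S (Cantor.to_nat (n, m)))). split; [lia|]. intros k Hk.
      destruct (Nat.eq_dec k m) as [->|]; [lia|]. specialize (IH k). lia. }
    destruct Hb as [N [HN Hb]].
    destruct (H N) as [x' [y' [z' [Hx [Hy [Hz HQ]]]]]].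
    exists x', y', (fun k => z' (Cantor.to_nat (n, k))).
    repeat split; try apply HQ; intros i Hi; [apply Hx|apply Hy|apply Hz, Hb]; lia.
  - intros x y. split.
    + intro Hn. assert (Hz : forall n, exists z, K n x y z) by (intro n; now apply HK).
      apply (choice _) in Hz as [z Hz].
      exists (fun k => z (fst (Cantor.of_nat k)) (snd (Cantor.of_nat k))). intro n.
      replace (fun k => _) with (z n); [apply Hz|].
      apply functional_extensionality. intro k. now rewrite Cantor.cancel_of_to.
    + intros [z Hz] n. apply HK. eauto.
Qed.

(** Analytic sets are not closed under complements, so the induction carries each set together with
    its complement. *)
Lemma borel2_analytic (A : cantor * cantor -> Prop) :
  borel2 A -> analytic2 A /\ analytic2 (fun p => ~ A p).
Proof.
  intro HA. induction HA as [A [n [b [H|H]]]|A _ [I1 I2]|A _ IH|A B _ [I1 I2] E].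
  - split.
    + apply analytic2_ext with (2 := fun p => iff_sym (H p)).
      apply (analytic2_fst n (fun c => c = b)).
    + apply analytic2_ext with (fun p => ~ fst p n = b); [|intro p; now rewrite H].
      apply (analytic2_fst n (fun c => ~ c = b)).
  - split.
    + apply analytic2_ext with (2 := fun p => iff_sym (H p)).
      apply (analytic2_snd n (fun c => c = b)).
    + apply analytic2_ext with (fun p => ~ snd p n = b); [|intro p; now rewrite H].
      apply (analytic2_snd n (fun c => ~ c = b)).
  - split; [exact I2|]. apply analytic2_ext with A; [exact I1|]. intro p. tauto.
  - split.
    + apply analytic2_ex. intro n. apply IH.
    + apply analytic2_ext with (fun p => forall n, ~ A n p).
      * apply (analytic2_all (fun n p => ~ A n p)). intro n. apply IH.
      * intro p. split; [intros H [n Hn]; now apply (H n)|]. eauto.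
  - split; [now apply analytic2_ext with A|].
    apply analytic2_ext with (fun p => ~ A p); [exact I2|]. intro p. now rewrite E.
Qed.

Definition parity (w : nat -> nat) : cantor := fun k => Nat.odd (w k).

Definition closed2 (K : cantor -> (nat -> nat) -> Prop) : Prop :=
  forall y w,
    (forall n, exists y' w', agree n y y' /\ agree n w w' /\ K y' w') -> K y w.

(* The real [x] and the witness [z] are merged into [w k = 2 z k + x k]. *)
Lemma analytic2_parity (A : cantor * cantor -> Prop) :
  analytic2 A ->
  exists K, closed2 K /\ forall x y, A (x, y) <-> exists w, K y w /\ x = parity w.
Proof.
  intros [K [HK H]].
  exists (fun y w => K (parity w) y (fun k => Nat.div2 (w k))). split.
  - intros y w Hn. apply HK. intro n. destruct (Hn n) as [y' [w' [Hy [Hw HQ]]]].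
    exists (parity w'), y', (fun k => Nat.div2 (w' k)).
    repeat split; auto; intros i Hi; unfold parity; now rewrite Hw.
  - intros x y. rewrite H. split.
    + intros [z Hz]. exists (fun k => Nat.b2n (x k) + 2 * z k).
      assert (E : x = parity (fun k => Nat.b2n (x k) + 2 * z k)).
      { apply functional_extensionality. intro k. unfold parity.
        now rewrite <- Nat.bit0_odd, Nat.add_b2n_double_bit0. }
      split; [|exact E]. rewrite <- E.
      replace (fun k => Nat.div2 _) with z; [exact Hz|].
      apply functional_extensionality. intro k.
      now rewrite Nat.div2_div, Nat.add_b2n_double_div2.
    + intros [w [Hw ->]]. eauto.
Qed.

(** * The Lusin-Novikov theorem *)

(** Brouwer's tree notations for countable ordinals, which index the derivatives. *)
Inductive ord : Type :=
| OZ : ord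
| OS : ord -> ord
| OSup : (nat -> ord) -> ord.

(** A witness [w] carries its real in [parity w], so comparing parities makes the nodes lead to
    distinct reals and not merely to distinct witnesses. *)
Definition incompatible (u v : list nat) : Prop :=
  exists k a b, nth_error u k = Some a /\ nth_error v k = Some b /\ Nat.odd a <> Nat.odd b.

(* The Cantor-Bendixson style derivatives of the tree of the section [K y]: a node
   survives one more step if it has two surviving extensions with distinct parities. *)
Fixpoint der (K : cantor -> (nat -> nat) -> Prop) (y : cantor) (a : ord) (t : list nat) : Prop :=
  match a with
  | OZ => exists y' w', agree (length t) y y' /\ on t w' /\ K y' w'
  | OS a => exists u v, sub t u /\ sub t v /\ incompatible u v /\ der K y a u /\ der K y a v
  | OSup f => forall n, der K y (f n) t
  end.

Lemma der_OZ K y a t : der K y a t -> der K y OZ t.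
Proof.
  revert t. induction a as [|a IH|f IH]; intros t H.
  - exact H.
  - destruct H as [u [_ [Hu [_ [_ [H _]]]]]]. apply IH in H as [y' [w' [Hy [Hw H]]]].
    exists y', w'. split; [|split; [now apply sub_on with u | exact H]].
    intros i Hi. apply Hy. apply sub_length in Hu. lia.
  - apply (IH 0), H.
Qed.

Lemma der_OZ_local K y y' t : agree (length t) y y' -> der K y OZ t -> der K y' OZ t.
Proof.
  intros Hy [y1 [w [H1 H2]]]. exists y1, w. split; [|exact H2].
  intros i Hi. rewrite <- Hy by exact Hi. now apply H1.
Qed.

(** Stage [OZ] consults finitely many bits of [y], and later stages quantify only over finite
    strings and natural numbers, so no projection along Baire space occurs. *)
Lemma borel_der K a t : borel (fun y => der K y a t).
Proof.
  revert t. induction a as [|a IH|f IH]; intro t.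
  - apply (borel_local (length t)). intros x y Hxy. now apply der_OZ_local.
  - simpl. do 2 (apply borel_ex; [auto with enum|]; intro).
    repeat apply borel_and; try apply borel_const; apply IH.
  - simpl. apply borel_all; [auto with enum|]. intro n. apply IH.
Qed.

(* If [w] leaves the derivative tree when passing from stage [a] to stage [OS a], below the
   node [t], then the nodes of stage [a] above [t] determine [parity w]. *)
Lemma der_cover K a :
  exists g : nat -> cantor -> cantor, (forall i, borel_fun (g i)) /\
    forall y w n, K y w -> ~ der K y a (pre w n) -> exists i, parity w = g i y.
Proof.
  induction a as [|a [g [Hg IH]]|f IH].
  - exists (fun _ x => x). split; [intro; apply borel_fun_id|].
    intros y w n HK H. exfalso. apply H. exists y, w.
    split; [now intros i _|]. split; [apply on_pre | exact HK].
  - destruct (enumerable_list _ enumerable_nat) as [d Hd].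
    (* [h m y] is the real read from the parities of all stage-[a] nodes above the node [d m]. *)
    pose (h := fun m y (k : nat) =>
      if excluded_middle_informative
        (exists u, sub (d m) u /\ der K y a u /\ exists c, nth_error u k = Some c /\ Nat.odd c = true)
      then true else false).
    exists (fun i => let (b, m) := Cantor.of_nat i in if b =? 0 then g m else h m). split.
    + intro i. destruct (Cantor.of_nat i) as [b m]. destruct (b =? 0); [apply Hg|].
      apply borel_fun_asbool. intro k. apply borel_ex; [auto with enum|]. intro u.
      repeat apply borel_and; try apply borel_const. apply borel_der.
    + intros y w n HK H.
      (* Either all of [w] survives stage [a], and a disagreement with [h] would split [pre w n] and
         keep it at stage [OS a]; or some prefix is already lost at stage [a] and the induction
         hypothesis applies. *)
      destruct (classic (forall m, der K y a (pre w m))) as [Hall|Hnot].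
      * destruct (Hd (pre w n)) as [m Hm].
        exists (Cantor.to_nat (1, m)). rewrite Cantor.cancel_of_to. simpl.
        apply functional_extensionality. intro k. unfold parity, h. rewrite Hm.
        assert (Hw : sub (pre w n) (pre w (max n (S k)))).
        { apply on_sub_pre; [apply on_pre | rewrite length_pre; lia]. }
        assert (Hk : nth_error (pre w (max n (S k))) k = Some (w k)).
        { apply nth_error_pre. lia. }
        destruct (excluded_middle_informative _) as [[u [Hu [Du [c [Hc Oc]]]]]|Hn].
        -- apply NNPP. intro Hne. apply H. exists u, (pre w (max n (S k))).
           repeat (split; auto). exists k, c, (w k). repeat split; auto. congruence.
        -- apply not_true_is_false. intro Ht. apply Hn.
           exists (pre w (max n (S k))). eauto.
      * apply not_all_ex_not in Hnot as [m Hm].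
        destruct (IH y w m HK Hm) as [i Hi]. exists (Cantor.to_nat (0, i)).
        now rewrite Cantor.cancel_of_to.
  - apply (choice _) in IH as [g Hg].
    exists (fun i => let (b, m) := Cantor.of_nat i in g b m). split.
    + intro i. destruct (Cantor.of_nat i) as [b m]. apply Hg.
    + intros y w n HK H. simpl in H. apply not_all_ex_not in H as [b Hb].
      destruct (proj2 (Hg b) y w n HK Hb) as [i Hi]. exists (Cantor.to_nat (b, i)).
      now rewrite Cantor.cancel_of_to.
Qed.

(* Finite approximations [(s, L)] to a perfect set inside a section: [s] approximates the
   point [y] and the nodes in [L] approximate the perfect tree. *)
Definition approx : Type := list bool * list (list nat).

(** Stage zero is required for all points through the new string, so the relation concerns finite
    objects only and its rank does not depend on a point [y]. *)
Definition refines (K : cantor -> (nat -> nat) -> Prop) (q p : approx) : Prop :=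
  sub (fst p) (fst q) /\ length (fst p) < length (fst q) /\
  (forall t, In t (snd q) ->
     length t <= length (fst q) /\ forall y, on (fst q) y -> der K y OZ t) /\
  (forall t, In t (snd p) ->
     exists u v, In u (snd q) /\ In v (snd q) /\ sub t u /\ sub t v /\ incompatible u v).

Lemma incompatible_longer t u v :
  sub t u -> sub t v -> incompatible u v -> length t < length u /\ length t < length v.
Proof.
  intros Hu Hv [k [a [b [Ha [Hb Hab]]]]].
  assert (Hk : length t <= k).
  { destruct (Nat.le_gt_cases (length t) k) as [H|H]; [exact H|].
    apply (sub_back t u k a Hu H) in Ha. apply Hv in Ha. congruence. }
  apply nth_error_length in Ha, Hb. lia.
Qed.

Lemma infinite_descent {A : Type} (R : A -> A -> Prop) (a : A) :
  ~ Acc R a -> exists s : nat -> A, s 0 = a /\ forall n, R (s (S n)) (s n).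
Proof.
  intro Ha.
  assert (H : forall p : {a | ~ Acc R a}, exists q : {a | ~ Acc R a}, R (proj1_sig q) (proj1_sig p)).
  { intros [p Hp]. apply NNPP. intro Hn. apply Hp. constructor. intros q Hq.
    apply NNPP. intro Hacc. apply Hn. now exists (exist _ q Hacc). }
  apply (choice _) in H as [f Hf].
  exists (fun n => proj1_sig (nat_rect (fun _ => {a | ~ Acc R a}) (exist _ a Ha) (fun _ p => f p) n)).
  split; [reflexivity|]. intro n. simpl. apply Hf.
Qed.

(** An infinite sequence of refinements yields a point [y] and a tree that splits at each level.
    Closedness of [K] puts its branches into the section of [y], and one branch can be steered away
    from every enumerated real. *)
Lemma approx_acc K :
  closed2 K -> (forall y, countable_set (fun x => exists w, K y w /\ x = parity w)) ->
  Acc (refines K) ([], [[]]).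
Proof.
  intros HK HC. apply NNPP. intro Hacc.
  apply infinite_descent in Hacc as [p [H0 Hp]].
  pose (y := fun k => nth k (fst (p (S k))) false).
  assert (Hy : forall n, on (fst (p n)) y).
  { apply (chain_limit false (fun n => fst (p n))).
    - intro n. apply Hp.
    - intro n. induction n as [|n IH]; [lia|].
      destruct (Hp n) as [_ [Hl _]]. lia. }
  destruct (HC y) as [e He].
  (* Diagonalize: at each splitting one of the two nodes avoids the next enumerated real. *)
  assert (Hstep : forall nt : {nt : nat * list nat | In (snd nt) (snd (p (fst nt)))},
    exists nu : {nt : nat * list nat | In (snd nt) (snd (p (fst nt)))},
      fst (proj1_sig nu) = S (fst (proj1_sig nt)) /\
      sub (snd (proj1_sig nt)) (snd (proj1_sig nu)) /\
      length (snd (proj1_sig nt)) < length (snd (proj1_sig nu)) /\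
      forall x, e (fst (proj1_sig nt)) = Some x ->
        exists k a, nth_error (snd (proj1_sig nu)) k = Some a /\ Nat.odd a <> x k).
  { intros [[n t] Ht]. simpl in Ht |- *.
    destruct (Hp n) as [_ [_ [_ Hs]]].
    destruct (Hs t Ht) as [u [v [Iu [Iv [Su [Sv Huv]]]]]].
    destruct (incompatible_longer t u v Su Sv Huv) as [Lu Lv].
    assert (Hav : (forall x, e n = Some x -> exists k a, nth_error u k = Some a /\ Nat.odd a <> x k)
               \/ (forall x, e n = Some x -> exists k a, nth_error v k = Some a /\ Nat.odd a <> x k)).
    { destruct (e n) as [x|]; [|left; discriminate].
      destruct Huv as [k [a [b [Ha [Hb Hab]]]]].
      destruct (bool_dec (Nat.odd a) (x k)) as [E|E].
      - right. intros x' [= <-]. exists k, b. split; [exact Hb|congruence].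
      - left. intros x' [= <-]. eauto. }
    destruct Hav as [Hav|Hav].
    - exists (exist _ (S n, u) Iu). simpl. auto.
    - exists (exist _ (S n, v) Iv). simpl. auto. }
  apply (choice _) in Hstep as [f Hf].
  assert (I0 : In (snd (0, @nil nat)) (snd (p (fst (0, @nil nat))))).
  { simpl. rewrite H0. now left. }
  pose (s := nat_rect (fun _ => {nt : nat * list nat | In (snd nt) (snd (p (fst nt)))})
     (exist _ (0, []) I0) (fun _ q => f q)).
  assert (Hs1 : forall n, fst (proj1_sig (s n)) = n).
  { induction n as [|n IH]; [reflexivity|]. simpl. rewrite (proj1 (Hf (s n))). now rewrite IH. }
  pose (t := fun n => snd (proj1_sig (s n))).
  assert (Ht : forall n, In (t n) (snd (p n))).
  { intro n. unfold t. pose proof (proj2_sig (s n)) as H. simpl in H. now rewrite Hs1 in H. }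
  assert (Hsub : forall n, sub (t n) (t (S n))) by (intro n; apply (Hf (s n))).
  assert (Hlen : forall n, n <= length (t n)).
  { induction n as [|n IH]; [lia|].
    assert (length (t n) < length (t (S n))) by apply (Hf (s n)). lia. }
  pose (w := fun k => nth k (t (S k)) 0).
  assert (Hw : forall n, on (t n) w) by now apply chain_limit.
  assert (HKw : K y w).
  { apply HK. intro n.
    destruct (Hp n) as [_ [_ [Hv _]]]. destruct (Hv (t (S n)) (Ht (S n))) as [_ Hd].
    destruct (Hd y (Hy (S n))) as [y' [w' [Hy' [Hw' HK']]]].
    exists y', w'. specialize (Hlen (S n)). split; [|split; [|exact HK']].
    - intros i Hi. apply Hy'. lia.
    - intros i Hi. apply (on_on_agree (t (S n)) w w' (Hw (S n)) Hw'). lia. }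
  destruct (He (parity w)) as [n Hn]; [eauto|].
  destruct (proj2 (proj2 (proj2 (Hf (s n)))) (parity w)) as [k [a [Ha Hne]]].
  { now rewrite Hs1. }
  apply Hne. unfold parity. f_equal. symmetry. now apply (Hw (S n)).
Qed.

Lemma list_length_bound {A : Type} (L : list (list A)) :
  exists N, forall t, In t L -> length t <= N.
Proof.
  induction L as [|t L [N HN]]; [now exists 0|].
  exists (max (length t) N). intros u [<-|Hu]; [lia|]. specialize (HN u Hu). lia.
Qed.

(** The stage for [p] is the successor of the supremum of the stages of its refinements. If all
    nodes of [p] survived it, the surviving splittings with a long prefix of [y] would form a
    refinement of [p] that survives its own stage. *)
Lemma approx_killed K p :
  Acc (refines K) p ->
  exists a, forall y, on (fst p) y -> ~ forall t, In t (snd p) -> der K y a t.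
Proof.
  intro Hp. induction Hp as [p _ IH].
  assert (He : enumerable approx) by (unfold approx; auto with enum).
  destruct He as [d Hd].
  assert (Hf : forall n, exists a, refines K (d n) p ->
     forall y, on (fst (d n)) y -> ~ forall t, In t (snd (d n)) -> der K y a t).
  { intro n. destruct (classic (refines K (d n) p)) as [H|H].
    - destruct (IH _ H) as [a Ha]. now exists a.
    - now exists OZ. }
  apply (choice _) in Hf as [f Hf]. exists (OS (OSup f)).
  intros y Hy Hall.
  assert (Hc : forall t, exists uv : list nat * list nat, In t (snd p) ->
    sub t (fst uv) /\ sub t (snd uv) /\ incompatible (fst uv) (snd uv) /\
    der K y (OSup f) (fst uv) /\ der K y (OSup f) (snd uv)).
  { intro t. destruct (classic (In t (snd p))) as [H|H].
    - destruct (Hall t H) as [u [v Huv]]. now exists (u, v).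
    - now exists ([], []). }
  apply (choice _) in Hc as [c Hc].
  pose (L := flat_map (fun t => [fst (c t); snd (c t)]) (snd p)).
  destruct (list_length_bound L) as [N HN].
  assert (HL : forall u, In u L -> der K y (OSup f) u).
  { intros u Hu. apply in_flat_map in Hu as [t [Ht [<-|[<-|[]]]]]; now apply Hc. }
  (* The prefix of [y] must be strictly longer than the old string and at least as long as every
     node of [L], so that it alone decides stage zero for them. *)
  destruct (Hd (pre y (S (max (length (fst p)) N)), L)) as [n Hn].
  assert (Hr : refines K (d n) p).
  { rewrite Hn. split; [|split; [|split]]; simpl fst; simpl snd.
    - apply on_sub_pre; [exact Hy | lia].
    - rewrite length_pre. lia.
    - intros t Ht. specialize (HN t Ht). rewrite length_pre. split; [lia|].
      intros y' Hy'. apply der_OZ_local with y.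
      + apply on_pre_agree in Hy'. intros i Hi. apply Hy'. lia.
      + apply der_OZ with (OSup f). now apply HL.
    - intros t Ht. exists (fst (c t)), (snd (c t)).
      destruct (Hc t Ht) as [H1 [H2 [H3 _]]].
      repeat split; auto; apply in_flat_map; exists t; split; simpl; auto. }
  apply (Hf n Hr y).
  - rewrite Hn. apply on_pre.
  - rewrite Hn. intros t Ht. apply (HL t Ht n).
Qed.

(** The approximation consisting of the root is killed at one stage [a] for all [y] at once. So
    every witness leaves the tree at its empty prefix, and [der_cover] supplies a single list of
    Borel functions. *)
Lemma lusin_novikov (A : cantor * cantor -> Prop) :
  borel2 A -> (forall y, countable_set (fun x => A (x, y))) ->
  exists g : nat -> cantor -> cantor, (forall i, borel_fun (g i)) /\
    forall x y, A (x, y) -> exists i, x = g i y.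
Proof.
  intros HA HC. apply borel2_analytic in HA as [HA _].
  apply analytic2_parity in HA as [K [HK E]].
  assert (Hacc : Acc (refines K) ([], [[]])).
  { apply approx_acc; [exact HK|]. intro y. destruct (HC y) as [e He].
    exists e. intros x Hx. now apply He, E. }
  apply approx_killed in Hacc as [a Ha]. destruct (der_cover K a) as [g [Hg H]].
  exists g. split; [exact Hg|]. intros x y Hxy. apply E in Hxy as [w [Hw ->]].
  apply (H y w 0 Hw). intro D. apply (Ha y).
  - intros [|i] b; discriminate.
  - intros t [<-|[]]. exact D.
Qed.

(** * Perfect sets independent of countably many continuous functionals *)

(* Branches of the full binary tree are read backwards, so that the last bit comes first. *)
Fixpoint rpre (x : cantor) (n : nat) : list bool :=
  match n with
  | 0 => []
  | S n => x n :: rpre x n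
  end.

Lemma length_rpre x n : length (rpre x n) = n.
Proof. induction n; simpl; congruence. Qed.

Lemma rpre_agree x y n : rpre x n = rpre y n <-> agree n x y.
Proof.
  induction n as [|n IH]; simpl.
  - split; [intros _ i Hi; lia | reflexivity].
  - split.
    + intros [= H1 H2] i Hi. destruct (Nat.eq_dec i n) as [->|]; [exact H1|].
      apply IH; [exact H2 | lia].
    + intro H. f_equal; [apply H; lia|]. apply IH. intros i Hi. apply H. lia.
Qed.

Lemma agree_le {A : Type} (x y : nat -> A) m n : m <= n -> agree n x y -> agree m x y.
Proof. intros Hm H i Hi. apply H. lia. Qed.

Lemma agree_all {A : Type} (x y : nat -> A) : (forall n, agree n x y) -> x = y.
Proof. intro H. apply functional_extensionality. intro n. apply (H (S n)). lia. Qed.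

Fixpoint tuples {A : Type} (k : nat) (L : list A) : list (list A) :=
  match k with
  | 0 => [[]]
  | S k => flat_map (fun a => map (cons a) (tuples k L)) L
  end.

Lemma in_tuples {A : Type} (L : list A) l : incl l L -> In l (tuples (length l) L).
Proof.
  induction l as [|a l IH]; intro H; simpl; [now left|].
  apply in_flat_map. exists a. split; [apply H; now left|].
  apply in_map, IH. intros b Hb. apply H. now right.
Qed.

Definition strings (n : nat) : list (list bool) := tuples n [true; false].

Lemma in_strings s : In s (strings (length s)).
Proof. apply in_tuples. intros [] _; simpl; auto. Qed.

Lemma separating_level (l : list cantor) :
  exists n, forall x y, In x l -> In y l -> agree n x y -> x = y.
Proof.
  assert (H1 : forall (x : cantor) (l : list cantor),
    exists n, forall y, In y l -> agree n x y -> x = y).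
  { intros x l'. induction l' as [|z l' [n IH]]; [now exists 0|].
    destruct (classic (exists m, ~ agree m x z)) as [[m Hm]|Hm].
    - exists (max m n). intros y [<-|Hy] H.
      + exfalso. apply Hm. apply agree_le with (2 := H). lia.
      + apply IH; [exact Hy|]. apply agree_le with (2 := H). lia.
    - exists n. intros y [<-|Hy] H; [|now apply IH].
      apply agree_all. intro m. apply NNPP. eauto. }
  assert (H2 : forall l' : list cantor,
    exists n, forall x y, In x l' -> In y l -> agree n x y -> x = y).
  { induction l' as [|x l' [n IH]]; [now exists 0|].
    destruct (H1 x l) as [m Hm]. exists (max m n). intros x' y [<-|Hx] Hy H.
    - apply Hm; [exact Hy|]. apply agree_le with (2 := H). lia.
    - apply IH; auto. apply agree_le with (2 := H). lia. }
  apply H2.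
Qed.

(* Compactness of Cantor space: follow the branches along which infinitely good
   approximations to [w] remain. *)
Lemma range_closed (G : cantor -> cantor) :
  (forall x y n, agree n x y -> agree n (G x) (G y)) ->
  forall w, (forall n, exists x, agree n (G x) w) -> exists x, w = G x.
Proof.
  intros HG w Hw.
  pose (Q := fun s => forall n, exists x, rpre x (length s) = s /\ agree n (G x) w).
  assert (HQ : forall s : {s | Q s}, exists b, Q (b :: proj1_sig s)).
  { intros [s Hs]. simpl. apply NNPP. intro Hn.
    assert (H : forall b, exists n, forall x,
      rpre x (S (length s)) = b :: s -> ~ agree n (G x) w).
    { intro b. apply NNPP. intro Hb. apply Hn. exists b. intro n. apply NNPP. intro Hx.
      apply Hb. exists n. intros x H1 H2. apply Hx. now exists x. }
    destruct (H true) as [n1 H1], (H false) as [n2 H2].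
    destruct (Hs (max n1 n2)) as [x [Hx Hxw]].
    assert (A1 : agree n1 (G x) w) by (apply agree_le with (2 := Hxw); lia).
    assert (A2 : agree n2 (G x) w) by (apply agree_le with (2 := Hxw); lia).
    destruct (x (length s)) eqn:E; [apply (H1 x)|apply (H2 x)]; simpl; first [assumption | congruence]. }
  assert (Q0 : Q []).
  { intro n. destruct (Hw n) as [x Hx]. now exists x. }
  apply (choice _) in HQ as [f Hf].
  pose (s := nat_rect (fun _ => {s | Q s}) (exist _ [] Q0)
    (fun _ p => exist _ (f p :: proj1_sig p) (Hf p))).
  pose (x := fun n => f (s n)).
  assert (Hx : forall n, proj1_sig (s n) = rpre x n).
  { induction n as [|n IH]; [reflexivity|]. simpl. now rewrite IH. }
  exists x. apply agree_all. intro n.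
  destruct (proj2_sig (s n) n) as [x' [Hx' Hw']]. rewrite Hx, length_rpre in Hx'.
  apply rpre_agree in Hx'. intros i Hi. rewrite <- (Hw' i Hi).
  now apply (HG x' x n).
Qed.

(** Graphs of possibly partial functionals: [F j l n v] says that the [j]-th one, at the tuple [l],
    outputs the bit [v] at [n]. *)
Definition functionals := nat -> list cantor -> nat -> bool -> Prop.

Definition single_valued (F : functionals) : Prop :=
  forall j l n v v', F j l n v -> F j l n v' -> v = v'.

Definition continuous_functionals (F : functionals) : Prop :=
  forall j l n v, F j l n v -> exists m, forall l', Forall2 (agree m) l l' -> F j l' n v.

(** Attaches to a node of the full binary tree the string of the perfect tree built there so far. *)
Definition assignment := list bool -> list bool.

Definition requirement : Type := nat * list bool * list (list bool).

Definition satisfies (F : functionals) (u : assignment) (r : requirement) : Prop :=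
  let '(j, s, l) := r in
  forall h : list bool -> cantor, (forall t, on (u t) (h t)) ->
    ~ forall n, F j (map h l) n (h s n).

Definition extends (u u' : assignment) : Prop := forall s, sub (u s) (u' s).

Lemma extends_trans u u' u'' : extends u u' -> extends u' u'' -> extends u u''.
Proof. intros H H' s. eapply sub_trans; eauto. Qed.

Lemma satisfies_extends F u u' r : extends u u' -> satisfies F u r -> satisfies F u' r.
Proof.
  destruct r as [[j s] l]. intros Hu H h Hh. apply H. intro t.
  eapply sub_on; [apply Hu | apply Hh].
Qed.

(** Diagonalization at [length (u s)], the first open bit of the real at [s]. If the functional can
    converge there, the used parts of its arguments are frozen and the opposite bit is appended; as
    [s] is not among the arguments, these do not interfere. Otherwise the functional has no value
    there. *)
Lemma satisfy_one F u j s l :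
  single_valued F -> continuous_functionals F -> ~ In s l ->
  exists u', extends u u' /\ satisfies F u' (j, s, l).
Proof.
  intros F1 F2 Hs.
  destruct (classic (exists h v, (forall t, on (u t) (h t)) /\ F j (map h l) (length (u s)) v))
    as [[h [v [Hh HF]]]|Hn].
  - destruct (F2 _ _ _ _ HF) as [m Hm].
    exists (fun t => if list_eq_dec bool_dec t s then u s ++ [negb v]
                     else pre (h t) (max m (length (u t)))).
    split.
    + intro t. destruct (list_eq_dec bool_dec t s) as [->|_]; [apply sub_app|].
      apply on_sub_pre; [apply Hh | lia].
    + intros h' Hh' HF'.
      assert (E : h' s (length (u s)) = negb v).
      { apply (Hh' s). destruct (list_eq_dec bool_dec s s) as [_|]; [|easy].
        rewrite nth_error_app2, Nat.sub_diag by lia. reflexivity. }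
      assert (HF2 : F j (map h' l) (length (u s)) v).
      { apply Hm. clear HF HF' Hm. induction l as [|t l IH]; simpl; constructor.
        - specialize (Hh' t). destruct (list_eq_dec bool_dec t s) as [->|_].
          + exfalso. apply Hs. now left.
          + apply on_pre_agree in Hh'. apply agree_le with (2 := Hh'). lia.
        - apply IH. intro H. apply Hs. now right. }
      specialize (HF' (length (u s))). rewrite E in HF'.
      apply (F1 _ _ _ _ _ HF2) in HF'. now destruct v.
  - exists u. split; [intro; apply sub_refl|]. intros h Hh HF. apply Hn.
    exists h, (h s (length (u s))). auto.
Qed.

Lemma satisfy_list F (L : list requirement) u :
  single_valued F -> continuous_functionals F ->
  exists u', extends u u' /\
    forall j s l, In (j, s, l) L -> ~ In s l -> satisfies F u' (j, s, l).
Proof.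
  intros F1 F2. induction L as [|[[j s] l] L [u1 [E1 IH]]].
  - exists u. split; [intro; apply sub_refl | easy].
  - destruct (classic (In s l)) as [Hs|Hs].
    + exists u1. split; [exact E1|]. intros j' s' l' [[= <- <- <-]|H] Hn; [easy|]. now apply IH.
    + destruct (satisfy_one F u1 j s l F1 F2 Hs) as [u2 [E2 H2]].
      exists u2. split; [now apply extends_trans with u1|].
      intros j' s' l' [[= <- <- <-]|H] Hn; [exact H2|].
      apply satisfies_extends with u1; auto.
Qed.

Definition branch (u : assignment) : assignment :=
  fun s => match s with [] => [] | b :: s => u s ++ [b] end.

(** The bounds on index and tuple length keep the list finite, yet any functional and any tuple
    length occur at all large levels. *)
Definition level_requirements (n : nat) : list requirement :=
  list_prod (list_prod (seq 0 n) (strings n))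
    (flat_map (fun k => tuples k (strings n)) (seq 0 n)).

Lemma in_level_requirements n j s l :
  j < n -> length s = n -> length l < n -> (forall t, In t l -> length t = n) ->
  In (j, s, l) (level_requirements n).
Proof.
  intros Hj Hs Hl Ht. apply in_prod.
  - apply in_prod; [apply in_seq; lia|]. rewrite <- Hs. apply in_strings.
  - apply in_flat_map. exists (length l). split; [apply in_seq; lia|].
    apply in_tuples. intros t H. rewrite <- (Ht t H). apply in_strings.
Qed.

(** A fusion: level [S m] branches the strings of level [m], then meets the finitely many
    requirements of that level. An instance [(j, x, l)] is covered at a level that separates [x] and
    the members of [l]. *)
Lemma independent_perfect_set (F : functionals) :
  single_valued F -> continuous_functionals F ->
  exists G : cantor -> cantor,
    (forall x y n, agree n x y -> agree n (G x) (G y)) /\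
    (forall x y, G x = G y -> x = y) /\
    (forall j x l, ~ In x l -> ~ forall n, F j (map G l) n (G x n)).
Proof.
  intros F1 F2.
  pose proof (fun mu : nat * assignment =>
    satisfy_list F (level_requirements (S (fst mu))) (branch (snd mu)) F1 F2) as Hstep.
  apply (choice _) in Hstep as [step Hstep].
  pose (U := nat_rect (fun _ => assignment) (fun _ => []) (fun m u => step (m, u))).
  assert (HU : forall m, extends (branch (U m)) (U (S m))) by (intro m; apply (Hstep (m, U m))).
  assert (HS : forall m j s l, In (j, s, l) (level_requirements (S m)) -> ~ In s l ->
    satisfies F (U (S m)) (j, s, l)) by (intro m; apply (Hstep (m, U m))).
  clearbody U. clear Hstep step.
  assert (Hb : forall x m, sub (U m (rpre x m) ++ [x m]) (U (S m) (rpre x (S m)))).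
  { intros x m. apply (HU m (rpre x (S m))). }
  assert (Hsub : forall x m, sub (U m (rpre x m)) (U (S m) (rpre x (S m)))).
  { intros x m. eapply sub_trans; [apply sub_app | apply Hb]. }
  assert (Hlen : forall x m, m <= length (U m (rpre x m))).
  { intros x m. induction m as [|m IH]; [lia|].
    specialize (Hb x m). apply sub_length in Hb. rewrite length_app in Hb. simpl in *. lia. }
  pose (G := fun x n => nth n (U (S n) (rpre x (S n))) false).
  assert (HG : forall x m, on (U m (rpre x m)) (G x)).
  { intros x. exact (chain_limit false (fun m => U m (rpre x m)) (Hsub x) (Hlen x)). }
  exists G. split; [|split].
  - intros x y n Hxy i Hi. unfold G. replace (rpre y (S i)) with (rpre x (S i)); [reflexivity|].
    apply rpre_agree, agree_le with n; [lia | exact Hxy].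
  - intros x y Hxy. apply agree_all. intro n. apply rpre_agree.
    induction n as [|n IH]; [reflexivity|].
    (* The branching bit sits right after the string of the node, so [G z] reveals [z n] once
       [rpre z n] is known. *)
    assert (E : forall z, G z (length (U n (rpre z n))) = z n).
    { intro z. apply (sub_on _ _ _ (Hb z n) (HG z (S n))).
      rewrite nth_error_app2, Nat.sub_diag by lia. reflexivity. }
    simpl. f_equal; [|exact IH]. rewrite <- (E x), <- (E y), IH, Hxy. reflexivity.
  - intros j x l Hx HF.
    destruct (separating_level (x :: l)) as [n0 Hn0].
    pose (m := max n0 (max j (length l))).
    assert (Hm : forall a b, In a (x :: l) -> In b (x :: l) ->
      rpre a (S m) = rpre b (S m) -> a = b).
    { intros a b Ha Hb' H. apply Hn0; auto. apply rpre_agree in H.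
      apply agree_le with (2 := H). lia. }
    (* [satisfies] asks for reals at all nodes; nodes on none of the listed reals get their string
       padded with [false]. *)
    assert (Hh : forall s, exists z : cantor, on (U (S m) s) z /\
      forall a, In a (x :: l) -> rpre a (S m) = s -> z = G a).
    { intro s. destruct (classic (exists a, In a (x :: l) /\ rpre a (S m) = s)) as [[a [Ha <-]]|Hn].
      - exists (G a). split; [apply HG|]. intros b Hb' E. f_equal. symmetry. now apply Hm.
      - exists (fun i => nth i (U (S m) s) false). split; [apply on_default|].
        intros a Ha E. exfalso. eauto. }
    apply (choice _) in Hh as [h Hh].
    apply (HS m j (rpre x (S m)) (map (fun a => rpre a (S m)) l)) with (h := h).
    + apply in_level_requirements.
      * lia.
      * apply length_rpre.
      * rewrite length_map. lia.
      * intros t Ht. apply in_map_iff in Ht as [a [<- _]]. apply length_rpre.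
    + intro H. apply in_map_iff in H as [a [E Ha]]. apply Hx.
      replace x with a; [exact Ha|]. apply Hm; simpl; auto.
    + intro t. apply Hh.
    + rewrite map_map. intro n.
      replace (map (fun a => h (rpre a (S m))) l) with (map G l).
      * rewrite (proj2 (Hh (rpre x (S m))) x); simpl; auto.
      * apply map_ext_in. intros a Ha. symmetry. apply Hh; simpl; auto.
Qed.

(** * Oracle computations *)

Section EvalInduction.

Variables (o : cantor) (Q : code -> list nat -> nat -> Prop).

Hypothesis h_zero : forall args, Q CZero args 0.
Hypothesis h_succ : forall n args, Q CSucc (n :: args) (S n).
Hypothesis h_proj : forall i args, i < length args -> Q (CProj i) args (nth i args 0).
Hypothesis h_oracle : forall n args, Q COracle (n :: args) (if o n then 1 else 0).
Hypothesis h_comp : forall g hs args vs r,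
  Forall2 (fun h v => Q h args v) hs vs -> Q g vs r -> Q (CComp g hs) args r.
Hypothesis h_prec0 : forall g h args r, Q g args r -> Q (CPrec g h) (0 :: args) r.
Hypothesis h_precS : forall g h n args r r',
  Q (CPrec g h) (n :: args) r -> Q h (n :: r :: args) r' -> Q (CPrec g h) (S n :: args) r'.
Hypothesis h_mu : forall g args n,
  Q g (n :: args) 0 -> (forall m, m < n -> exists v, v <> 0 /\ Q g (m :: args) v) ->
  Q (CMu g) args n.

(** The [Forall2] in [ev_comp] and the existential in [ev_mu] call for a principle that gives
    hypotheses for the evaluations nested inside them. *)
Fixpoint eval_nested_ind c args r (H : eval o c args r) {struct H} : Q c args r.
Proof.
  destruct H as [args|n args|i args Hi|n args|g hs args vs r Hhs Hg|g h args r Hg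
                |g h n args r r' Hr Hh|g args n Hn Hm].
  - apply h_zero.
  - apply h_succ.
  - now apply h_proj.
  - apply h_oracle.
  - apply h_comp with vs; [|now apply eval_nested_ind].
    clear Hg. revert hs vs Hhs. fix IH 3. intros hs vs Hhs. destruct Hhs as [|h v hs vs Hh Hhs].
    + constructor.
    + constructor; [now apply eval_nested_ind | now apply IH].
  - now apply h_prec0, eval_nested_ind.
  - apply h_precS with r; now apply eval_nested_ind.
  - apply h_mu; [now apply eval_nested_ind|].
    intros m Hlt. destruct (Hm m Hlt) as [v [Hv He]]. exists v.
    split; [exact Hv | now apply eval_nested_ind].
Qed.

End EvalInduction.

Lemma eval_functional o c args r r' : eval o c args r -> eval o c args r' -> r = r'.
Proof.
  intro H. revert r'.
  induction H as [args|n args|i args Hi|n args|g hs args vs r Hhs Hg|g h args r Hg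
                |g h n args r r1 Hr Hh|g args n Hn Hm] using eval_nested_ind;
    intros r' H'; inversion H'; subst; try reflexivity.
  - match goal with Hv : Forall2 _ hs ?ws |- _ => assert (vs = ws) as -> end; [|auto].
    clear H' Hg. match goal with Hv : Forall2 (fun h v => eval o h args v) hs ?ws |- _ =>
      rename Hv into Hws; revert Hws; generalize ws end.
    induction Hhs as [|h v hs vs Hh _ IH]; intros ws Hws; inversion Hws; subst; [reflexivity|].
    f_equal; auto.
  - auto.
  - match goal with He : eval o (CPrec g h) (n :: args) ?s |- _ => assert (r = s) as -> end; auto.
  - match goal with |- n = ?k => destruct (Nat.lt_trichotomy n k) as [Hlt|[E|Hlt]] end.
    + match goal with Hk : forall m, m < r' -> _ |- _ => destruct (Hk n Hlt) as [v [Hv He]] end.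
      exfalso. apply Hv. symmetry. auto.
    + exact E.
    + destruct (Hm r' Hlt) as [v [Hv He]]. exfalso. apply Hv. auto.
Qed.

Lemma eval_use o c args r :
  eval o c args r -> exists m, forall o', agree m o o' -> eval o' c args r.
Proof.
  intro H.
  induction H as [args|n args|i args Hi|n args|g hs args vs r Hhs [m1 H1]|g h args r [m1 H1]
                |g h n args r r1 [m1 H1] [m2 H2]|g args n [m1 H1] Hm] using eval_nested_ind.
  - exists 0. constructor.
  - exists 0. constructor.
  - exists 0. now constructor.
  - exists (S n). intros o' Ho. rewrite (Ho n) by lia. constructor.
  - assert (Hl : exists m, forall o', agree m o o' -> Forall2 (fun h v => eval o' h args v) hs vs).
    { clear H1. induction Hhs as [|h v hs vs [m2 H2] _ [m3 H3]]; [exists 0; constructor|].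
      exists (max m2 m3). intros o' Ho.
      constructor; [apply H2|apply H3]; apply agree_le with (2 := Ho); lia. }
    destruct Hl as [m2 H2]. exists (max m1 m2). intros o' Ho. apply ev_comp with vs;
      [apply H2|apply H1]; apply agree_le with (2 := Ho); lia.
  - exists m1. intros o' Ho. constructor. auto.
  - exists (max m1 m2). intros o' Ho. apply ev_precS with r;
      [apply H1|apply H2]; apply agree_le with (2 := Ho); lia.
  - assert (Hl : forall k, k <= n -> exists m2, forall o', agree m2 o o' ->
      forall m, m < k -> exists v, v <> 0 /\ eval o' g (m :: args) v).
    { induction k as [|k IH]; intro Hk; [exists 0; intros; lia|].
      destruct IH as [m2 H2]; [lia|]. destruct (Hm k) as [v [Hv [m3 H3]]]; [lia|].
      exists (max m2 m3). intros o' Ho m Hlt. destruct (Nat.eq_dec m k) as [->|].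
      - exists v. split; [exact Hv|]. apply H3. apply agree_le with (2 := Ho). lia.
      - apply H2; [|lia]. apply agree_le with (2 := Ho). lia. }
    destruct (Hl n (le_n n)) as [m2 H2]. exists (max m1 m2). intros o' Ho.
    constructor; [apply H1|apply H2]; apply agree_le with (2 := Ho); lia.
Qed.

Fixpoint subst_oracle (d : code) (c : code) : code :=
  match c with
  | COracle => CComp d [CProj 0]
  | CComp g hs => CComp (subst_oracle d g) (map (subst_oracle d) hs)
  | CPrec g h => CPrec (subst_oracle d g) (subst_oracle d h)
  | CMu g => CMu (subst_oracle d g)
  | c => c
  end.

Lemma eval_proj0 o n args : eval o (CProj 0) (n :: args) n.
Proof. apply (ev_proj o 0 (n :: args)). simpl. lia. Qed.

Lemma eval_proj1 o n r args : eval o (CProj 1) (n :: r :: args) r.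
Proof. apply (ev_proj o 1 (n :: r :: args)). simpl. lia. Qed.

Lemma eval_comp1 o g h args v r :
  eval o h args v -> eval o g [v] r -> eval o (CComp g [h]) args r.
Proof. intros H1 H2. apply ev_comp with [v]; auto. Qed.

Lemma turing_le_refl x : turing_le x x.
Proof. exists COracle. intro n. constructor. Qed.

Lemma turing_le_trans x y z : turing_le x y -> turing_le y z -> turing_le x z.
Proof.
  intros [c Hc] [d Hd]. exists (subst_oracle d c).
  assert (H : forall e args r, eval y e args r -> eval z (subst_oracle d e) args r).
  { intros e args r He.
    induction He as [args|n args|i args Hi|n args|g hs args vs r Hhs Hg|g h args r Hg
                |g h n args r r1 Hr Hh|g args n Hn Hm] using eval_nested_ind; simpl.
    - constructor.
    - constructor.
    - now constructor.
    - apply eval_comp1 with n; [apply eval_proj0 | apply Hd].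
    - apply ev_comp with vs; [|exact Hg]. clear Hg. induction Hhs; simpl; constructor; auto.
    - now constructor.
    - now apply ev_precS with r.
    - now constructor. }
  intro n. apply H, Hc.
Qed.

(** The bit [x 0] is wired into the code as the base value of a primitive recursion whose step calls
    [c]. *)
Lemma turing_le_tail x y : turing_le (fun k => x (S k)) y -> turing_le x y.
Proof.
  intros [c Hc].
  exists (CPrec (if x 0 then CComp CSucc [CZero] else CZero) (CComp c [CProj 0])).
  assert (H : forall n, eval y (CPrec (if x 0 then CComp CSucc [CZero] else CZero)
    (CComp c [CProj 0])) [n] (if x n then 1 else 0)).
  { induction n as [|n IH].
    - constructor. destruct (x 0); [|constructor].
      apply eval_comp1 with 0; constructor.
    - apply ev_precS with (1 := IH). apply eval_comp1 with n; [apply eval_proj0 | apply Hc]. }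
  exact H.
Qed.

Lemma turing_le_eventually K : forall x x' y,
  (forall k, K <= k -> x k = x' k) -> turing_le x y -> turing_le x' y.
Proof.
  induction K as [|K IH]; intros x x' y H Hx.
  - replace x' with x; [exact Hx|]. apply functional_extensionality. intro k. apply H. lia.
  - apply turing_le_tail. apply IH with (fun k => x (S k)).
    + intros k Hk. apply H. lia.
    + destruct Hx as [c Hc]. exists (CComp c [CSucc]). intro n.
      apply eval_comp1 with (S n); [constructor | apply Hc].
Qed.

(** [pos i k] is [2^i * (2 * k + 1) - 1], the place of entry [k] of column [i]; doubling and
    successor suffice to compute it. *)
Fixpoint pos (i k : nat) : nat :=
  match i with
  | 0 => 2 * k
  | S i => S (2 * pos i k)
  end.

Lemma pos_inj i k : forall i' k', pos i k = pos i' k' -> i = i' /\ k = k'.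
Proof.
  induction i as [|i IH]; intros [|i'] k' H; cbn -[Nat.mul] in H.
  - lia.
  - lia.
  - lia.
  - destruct (IH i' k') as [-> ->]; [lia | auto].
Qed.

Lemma pos_ge i k : k <= pos i k.
Proof. induction i; cbn -[Nat.mul]; lia. Qed.

Definition double_code : code := CPrec CZero (CComp CSucc [CComp CSucc [CProj 1]]).

Lemma eval_double o n : eval o double_code [n] (2 * n).
Proof.
  induction n as [|n IH]; [repeat constructor|].
  replace (2 * S n) with (S (S (2 * n))) by lia.
  apply ev_precS with (1 := IH). apply eval_comp1 with (S (2 * n)); [|constructor].
  apply eval_comp1 with (2 * n); [apply eval_proj1 | constructor].
Qed.

Fixpoint pos_code (i : nat) : code :=
  match i with
  | 0 => double_code
  | S i => CComp CSucc [CComp double_code [pos_code i]]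
  end.

Lemma eval_pos o i k : eval o (pos_code i) [k] (pos i k).
Proof.
  induction i as [|i IH]; [apply eval_double|]. cbn -[Nat.mul].
  apply eval_comp1 with (2 * pos i k); [|constructor].
  apply eval_comp1 with (pos i k); [exact IH | apply eval_double].
Qed.

Lemma turing_le_column a i : turing_le (fun k => a (pos i k)) a.
Proof.
  exists (CComp COracle [pos_code i]). intro k.
  apply eval_comp1 with (pos i k); [apply eval_pos | constructor].
Qed.

(** Asking for the same value at every real through [s] avoids tracking the use; by
    [eval_converges], long prefixes of an oracle capture each halting computation. *)
Definition converges (e : code) (s : list bool) (n : nat) (v : bool) : Prop :=
  forall o, on s o -> eval o e [n] (if v then 1 else 0).

Lemma converges_eval e s o n (v v' : bool) :
  converges e s n v -> on s o -> eval o e [n] (if v' then 1 else 0) -> v = v'.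
Proof.
  intros H Ho H'. pose proof (eval_functional _ _ _ _ _ (H o Ho) H') as E.
  destruct v, v'; congruence.
Qed.

Lemma converges_functional e s n v v' : converges e s n v -> converges e s n v' -> v = v'.
Proof.
  intros H H'. apply (converges_eval e s (fun i => nth i s false) n v v' H).
  - apply on_default.
  - apply H', on_default.
Qed.

Lemma converges_sub e s s' n v : sub s s' -> converges e s n v -> converges e s' n v.
Proof. intros Hs H o Ho. apply H. now apply sub_on with s'. Qed.

Lemma eval_converges e o n (v : bool) :
  eval o e [n] (if v then 1 else 0) ->
  exists m, forall m', m <= m' -> converges e (pre o m') n v.
Proof.
  intro H. destruct (eval_use _ _ _ _ H) as [m Hm]. exists m. intros m1 Hle o1 Ho.
  apply Hm. apply on_pre_agree in Ho. now apply agree_le with m1.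
Qed.

(** * Least-choice sequences of strings *)

(** Taking the [d]-least admissible string makes the run unique, hence definable from [step] by
    countable quantifiers. It is a relation because a run may get stuck. *)
Fixpoint least_run (d : nat -> list bool) (step : nat -> list bool -> list bool -> Prop)
  (q : list bool) (n : nat) (s : list bool) : Prop :=
  match n with
  | 0 => s = q
  | S n => exists r c, s = d c /\ least_run d step q n r /\ step n r (d c) /\
             forall c', c' < c -> ~ step n r (d c')
  end.

Lemma least_run_functional d step q n : forall s s',
  least_run d step q n s -> least_run d step q n s' -> s = s'.
Proof.
  induction n as [|n IH]; simpl; intros s s'; [congruence|].
  intros [r [c [-> [Hr [Hs Hl]]]]] [r' [c' [-> [Hr' [Hs' Hl']]]]].
  assert (r = r') as <- by auto.
  destruct (Nat.lt_trichotomy c c') as [H|[->|H]].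
  - now destruct (Hl' c H).
  - reflexivity.
  - now destruct (Hl c' H).
Qed.

Lemma least_run_step d step q n s r :
  (forall s, exists c, d c = s) -> least_run d step q n s -> step n s r ->
  exists t, least_run d step q (S n) t /\ step n s t.
Proof.
  intros Hd Hs Hr.
  assert (Hm : exists c, step n s (d c) /\ forall c', c' < c -> ~ step n s (d c')).
  { destruct (Hd r) as [c <-]. revert Hr. induction c as [c IH] using lt_wf_ind. intro Hc.
    destruct (classic (exists c', c' < c /\ step n s (d c'))) as [[c' [Hlt Hc']]|Hn].
    - now apply IH with c'.
    - exists c. split; [exact Hc|]. intros c' Hlt H. apply Hn. eauto. }
  destruct Hm as [c [Hc Hl]]. exists (d c). split; [|exact Hc]. simpl. exists s, c. auto.
Qed.

Lemma least_run_exists d (step : nat -> list bool -> list bool -> Prop) q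
  (I : list bool -> Prop) :
  (forall s, exists c, d c = s) -> I q ->
  (forall n s, I s -> exists t, step n s t) -> (forall n s t, I s -> step n s t -> I t) ->
  exists p : nat -> list bool, p 0 = q /\
    forall n, least_run d step q n (p n) /\ step n (p n) (p (S n)) /\ I (p n).
Proof.
  intros Hd Iq He Hi.
  assert (H : forall n, exists s, least_run d step q n s /\ I s).
  { induction n as [|n [s [Hs Is]]]; [now exists q|].
    destruct (He n s Is) as [r Hr]. destruct (least_run_step d step q n s r Hd Hs Hr) as [t [Ht Hst]].
    exists t. split; [exact Ht | now apply (Hi n s)]. }
  apply (choice _) in H as [p Hp]. exists p.
  split; [apply (Hp 0)|]. intro n. destruct (Hp n) as [H1 H2]. split; [exact H1|].
  split; [|exact H2]. destruct (He n (p n) H2) as [r Hr].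
  destruct (least_run_step d step q n (p n) r Hd H1 Hr) as [t [Ht Hst]].
  now rewrite (least_run_functional d step q (S n) (p (S n)) t (proj1 (Hp (S n))) Ht).
Qed.

(** * Upper bounds of countably many members of an independent perfect set *)

(* Conditions are finite strings; those above [s] must copy [X i] into column [i], for
   every [i < k], at all positions from [length s] on. *)
Definition ext (X : nat -> cantor) (k : nat) (s s' : list bool) : Prop :=
  sub s s' /\
  forall i j b, i < k -> length s <= pos i j -> nth_error s' (pos i j) = Some b -> b = X i j.

Definition ext_real (X : nat -> cantor) (k : nat) (s : list bool) (a : cantor) : Prop :=
  on s a /\ forall i j, i < k -> length s <= pos i j -> a (pos i j) = X i j.

Lemma ext_refl X k s : ext X k s s.
Proof.
  split; [apply sub_refl|]. intros i j b _ H Hb. apply nth_error_length in Hb. lia.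
Qed.

Lemma ext_trans X k s t u : ext X k s t -> ext X k t u -> ext X k s u.
Proof.
  intros [S1 E1] [S2 E2]. split; [now apply sub_trans with t|].
  intros i j b Hi Hl Hb. destruct (Nat.le_gt_cases (length t) (pos i j)) as [H|H].
  - now apply E2.
  - apply E1; auto. now apply sub_back with u.
Qed.

Lemma ext_le X k k' s t : k' <= k -> ext X k s t -> ext X k' s t.
Proof. intros Hk [H1 H2]. split; [exact H1|]. intros i j b Hi. apply H2. lia. Qed.

Lemma ext_local X X' k s t :
  (forall i, i < k -> agree (length t) (X i) (X' i)) -> ext X k s t -> ext X' k s t.
Proof.
  intros HX [H1 H2]. split; [exact H1|]. intros i j b Hi Hl Hb.
  rewrite <- (HX i Hi j); [now apply H2|].
  apply nth_error_length in Hb. pose proof (pos_ge i j). lia.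
Qed.

Lemma ext_real_pre X k s a n : ext_real X k s a -> length s <= n -> ext X k s (pre a n).
Proof.
  intros [H1 H2] Hn. split; [now apply on_sub_pre|]. intros i j b Hi Hl Hb.
  apply nth_error_pre_inv in Hb as [_ ->]. now apply H2.
Qed.

Lemma ext_real_exists X k s : exists a, ext_real X k s a.
Proof.
  exists (fun n => match nth_error s n with
    | Some b => b
    | None => if excluded_middle_informative (exists i j, n = pos i j /\ X i j = true)
              then true else false
    end).
  split.
  - intros i b H. now rewrite H.
  - intros i j _ Hl. rewrite (proj2 (nth_error_None s _) Hl).
    destruct (excluded_middle_informative _) as [[i' [j' [E Ht]]]|Hn].
    + apply pos_inj in E as [-> ->]. congruence.
    + symmetry. apply not_true_is_false. intro H. apply Hn. eauto.
Qed.

Definition search (e : code) (X : nat -> cantor) (k n : nat) (r s : list bool) : Prop :=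
  ext X k r s /\ exists v, converges e s n v.

Definition nth_real (l : list cantor) (i : nat) : cantor := nth i l (fun _ => false).

(* The functional that computes, from the reals in [l], the values of [e] along the greedy
   sequence of conditions starting at [q]. *)
Definition greedy (d : nat -> list bool) (e : code) (q : list bool)
  (l : list cantor) (n : nat) (v : bool) : Prop :=
  exists r, least_run d (search e (nth_real l) (length l)) q (S n) r /\ converges e r n v.

Lemma greedy_functional d e q l n v v' :
  greedy d e q l n v -> greedy d e q l n v' -> v = v'.
Proof.
  intros [r [Hr Hv]] [r' [Hr' Hv']].
  rewrite (least_run_functional _ _ _ _ _ _ Hr' Hr) in Hv'.
  now apply (converges_functional e r n).
Qed.

Lemma Forall2_nth_real m l l' :
  Forall2 (agree m) l l' -> length l = length l' /\ forall i, agree m (nth_real l i) (nth_real l' i).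
Proof.
  intro H. induction H as [|x x' l l' Hx _ [IH1 IH2]].
  - split; [reflexivity|]. now intros i j.
  - split; [simpl; congruence|]. intros [|i]; [exact Hx | apply IH2].
Qed.

Lemma search_local e l l' m n r s :
  Forall2 (agree m) l l' -> length s <= m ->
  search e (nth_real l) (length l) n r s <-> search e (nth_real l') (length l') n r s.
Proof.
  intros Hl Hm. apply Forall2_nth_real in Hl as [El Hl]. rewrite El.
  split; intros [H1 H2]; (split; [|exact H2]).
  - apply ext_local with (2 := H1). intros i _. now apply agree_le with m.
  - apply ext_local with (2 := H1). intros i _ j Hj. symmetry. apply Hl. lia.
Qed.

(** Each step of a run tests only [d 0, ..., d c], and each test reads the reals only up to the
    length of the tested string. *)
Lemma greedy_continuous d e q l n v :
  greedy d e q l n v -> exists m, forall l', Forall2 (agree m) l l' -> greedy d e q l' n v.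
Proof.
  intros [r [Hr Hv]].
  assert (H : exists m, forall l', Forall2 (agree m) l l' ->
    least_run d (search e (nth_real l') (length l')) q (S n) r).
  { clear Hv. revert r Hr. generalize (S n) as k. clear n.
    induction k as [|k IH]; intros r Hr; [now exists 0|].
    destruct Hr as [t [c [-> [Ht [Hs Hmin]]]]]. destruct (IH t Ht) as [m1 H1].
    destruct (list_length_bound (map d (seq 0 (S c)))) as [m2 H2].
    exists (max m1 m2). intros l' Hl.
    assert (Hc : forall c', c' <= c ->
      search e (nth_real l) (length l) k t (d c') <-> search e (nth_real l') (length l') k t (d c')).
    { intros c' Hc'. apply search_local with (1 := Hl).
      assert (length (d c') <= m2) by (apply H2, in_map, in_seq; lia). lia. }
    exists t, c. split; [reflexivity|]. split; [|split].
    - apply H1. clear -Hl. induction Hl as [|x x' l l' Hx _ IHl]; constructor; [|exact IHl].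
      apply agree_le with (2 := Hx). lia.
    - now apply Hc.
    - intros c' Hlt H. apply (Hmin c' Hlt). apply Hc; [lia | exact H]. }
  destruct H as [m Hm]. exists m. intros l' Hl. exists r. auto.
Qed.

(* Arithmetical, hence Borel in [X], form of: no real extending [s] computes through [e] a
   member of the perfect set other than [X 0, ..., X (k - 1)]. The output leaves the perfect
   set, or is partial, or never becomes incompatible with all the [X i]. *)
Definition settles (G : cantor -> cantor) (e : code) (X : nat -> cantor) (k : nat)
  (s : list bool) : Prop :=
  (exists w, (forall n v, nth_error w n = Some v -> converges e s n v) /\
     forall x, ~ on w (G x)) \/
  (exists n, forall r, ext X k s r -> forall v, ~ converges e r n v) \/
  (forall r, ext X k s r ->
     exists i, i < k /\ forall n v, converges e r n v -> v = X i n).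

(** The computation of [G z] itself refutes the first two clauses. Under the third, if [G z]
    differed from each [X i] with [i < k], a long prefix of [a] would force a disagreement with all
    of them. *)
Lemma settles_sound G e X k s a z :
  settles G e X k s -> ext_real X k s a ->
  (forall n, eval a e [n] (if G z n then 1 else 0)) -> exists i, i < k /\ G z = X i.
Proof.
  intros [[w [Hw Hx]]|[[n Hn]|H]] Ha He.
  - exfalso. apply (Hx z). intros n v Hv. symmetry.
    apply (converges_eval e s a n); auto. apply Ha.
  - exfalso. destruct (eval_converges _ _ _ _ (He n)) as [m Hm].
    apply (Hn (pre a (max m (length s)))) with (v := G z n).
    + apply ext_real_pre; [exact Ha | lia].
    + apply Hm. lia.
  - apply NNPP. intro Hne.
    assert (Hd : forall k', k' <= k -> exists N, forall i, i < k' -> exists n, n < N /\ G z n <> X i n).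
    { induction k' as [|k' IH]; intro Hk; [exists 0; intros; lia|].
      destruct IH as [N HN]; [lia|].
      assert (Hk' : exists n, G z n <> X k' n).
      { apply NNPP. intro Hn. apply Hne. exists k'. split; [lia|].
        apply functional_extensionality. intro n. apply NNPP. eauto. }
      destruct Hk' as [n Hn]. exists (max N (S n)). intros i Hi.
      destruct (Nat.eq_dec i k') as [->|].
      - exists n. split; [lia | exact Hn].
      - destruct (HN i) as [n' [Hn' H']]; [lia|]. exists n'. split; [lia | exact H']. }
    destruct (Hd k (le_n k)) as [N HN].
    assert (Hm : forall N', exists m, forall m', m <= m' ->
      forall n, n < N' -> converges e (pre a m') n (G z n)).
    { induction N' as [|N' [m1 H1]]; [exists 0; intros; lia|].
      destruct (eval_converges _ _ _ _ (He N')) as [m2 H2]. exists (max m1 m2).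
      intros m' Hm' n Hn. destruct (Nat.eq_dec n N') as [->|]; [apply H2|apply H1]; lia. }
    destruct (Hm N) as [m Hm']. clear Hm.
    destruct (H (pre a (max m (length s)))) as [i [Hi Hv]].
    { apply ext_real_pre; [exact Ha | lia]. }
    destruct (HN i Hi) as [n [Hn Hdiff]]. apply Hdiff, Hv, Hm'; lia.
Qed.

Section Bounds.

Variable d : nat -> list bool.
Hypothesis d_onto : forall s, exists c, d c = s.

Variable ec : nat -> code.
Hypothesis ec_onto : forall c, exists n, ec n = c.

Variable G : cantor -> cantor.
Hypothesis G_lip : forall x y n, agree n x y -> agree n (G x) (G y).
Hypothesis G_inj : forall x y, G x = G y -> x = y.
Hypothesis G_indep : forall e q x l,
  ~ In x l -> ~ forall n, greedy d e q (map G l) n (G x n).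

(* If no extension of [p] settles [e], the greedy sequence computes from finitely many
   members of the perfect set a member different from all of them. *)
Lemma settles_dense e (x : nat -> cantor) k p :
  exists q, ext (fun i => G (x i)) k p q /\ settles G e (fun i => G (x i)) k q.
Proof.
  set (X := fun i => G (x i)). apply NNPP. intro Hno.
  (* As [p] fails the third clause, a single extension [q] disagrees with every [X i], [i < k]. *)
  assert (Hq : exists q, ext X k p q /\
    forall i, i < k -> exists n v, converges e q n v /\ v <> X i n).
  { apply NNPP. intro Hn. apply Hno. exists p. split; [apply ext_refl|]. right; right.
    intros r Hr. apply NNPP. intro Hi. apply Hn. exists r. split; [exact Hr|].
    intros i Hik. apply NNPP. intro Hv. apply Hi. exists i. split; [exact Hik|].
    intros n v Hc. apply NNPP. intro Hne. apply Hv. eauto. }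
  destruct Hq as [q [Hpq Hq]].
  pose (l := map G (pre x k)).
  assert (Ll : length l = k) by (unfold l; now rewrite length_map, length_pre).
  assert (Hl : forall i, i < k -> nth_real l i = X i).
  { intros i Hi. apply nth_error_nth. unfold l. rewrite nth_error_map, nth_error_pre; easy. }
  assert (Ext : forall s t, ext (nth_real l) k s t <-> ext X k s t).
  { intros s t. split; apply ext_local; intros i Hi; now rewrite Hl. }
  (* Failure of the second clause keeps the greedy search from getting stuck. *)
  destruct (least_run_exists d (search e (nth_real l) (length l)) q (fun s => ext X k q s))
    as [r [R0 R]].
  - exact d_onto.
  - apply ext_refl.
  - intros n s Hs. apply NNPP. intro Hn. apply Hno. exists s.
    split; [now apply ext_trans with q|]. right; left. exists n. intros r Hr v Hv.
    apply Hn. exists r. split; [|eauto]. rewrite Ll. now apply Ext.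
  - intros n s t Hs [Ht _]. rewrite Ll in Ht. apply Ext in Ht. now apply ext_trans with s.
  - assert (Hv : forall n, exists v, converges e (r (S n)) n v).
    { intro n. apply (R n). }
    apply (choice _) in Hv as [w Hw].
    assert (Hsub : forall m n, m <= n -> sub (r m) (r n)).
    { apply sub_chain. intro n. apply (R n). }
    (* Failure of the first clause makes every prefix of the output [w] a prefix of a member of the
       perfect set; by compactness [w] is a member. *)
    destruct (range_closed G G_lip w) as [z Hz].
    { intro n. apply NNPP. intro Hn. apply Hno. exists (r n).
      split; [apply ext_trans with q; [exact Hpq | apply R]|]. left.
      exists (pre w n). split.
      - intros i v Hi. apply nth_error_pre_inv in Hi as [Hi ->].
        apply converges_sub with (r (S i)); [now apply Hsub | apply Hw].
      - intros y Hy. apply Hn. exists y. apply on_pre_agree in Hy.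
        intros i Hi. symmetry. now apply Hy. }
    apply (G_indep e q z (pre x k)).
    + intro Hin. apply in_map_iff in Hin as [i [Ei Hi]]. apply in_seq in Hi.
      destruct (Hq i) as [n [v [Hv Hne]]]; [lia|]. apply Hne. unfold X. rewrite Ei, <- Hz.
      apply (converges_functional e (r (S n)) n); [|apply Hw].
      apply converges_sub with q; [apply R | exact Hv].
    + intro n. exists (r (S n)). fold l. split; [apply R|]. rewrite <- Hz. apply Hw.
Qed.

Definition stage (X : nat -> cantor) (n : nat) (s t : list bool) : Prop :=
  ext X n s t /\ length s < length t /\ settles G (ec n) X n t.

(** The limit of the least run of [stage], given bit by bit so that it is Borel in [X]. Lengths grow
    at every stage, so condition [S n] has a bit at [n]. *)
Definition upper_bound (X : nat -> cantor) : cantor := fun n =>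
  if excluded_middle_informative
    (exists s, least_run d (stage X) [] (S n) s /\ nth_error s n = Some true)
  then true else false.

(** Past condition [S i], column [i] copies [G (x i)], so the bound computes it up to finitely many
    bits. A code computing some [G z] from the bound was settled at its own stage [n], which makes
    [z] one of [x 0, ..., x (n - 1)]. *)
Lemma upper_bound_spec (x : nat -> cantor) :
  let a := upper_bound (fun i => G (x i)) in
  (forall i, turing_le (G (x i)) a) /\
  (forall z, turing_le (G z) a -> exists i, z = x i).
Proof.
  set (X := fun i => G (x i)). intro a.
  destruct (least_run_exists d (stage X) [] (fun _ => True)) as [p [P0 Hp]].
  { exact d_onto. }
  { exact I. }
  { intros n s _. destruct (ext_real_exists X n s) as [b Hb].
    pose proof (ext_real_pre X n s b (S (length s)) Hb (le_S _ _ (le_n _))) as H1.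
    destruct (settles_dense (ec n) x n (pre b (S (length s)))) as [t [Ht Hst]].
    exists t. split; [now apply ext_trans with (pre b (S (length s)))|].
    split; [|exact Hst]. destruct Ht as [Ht _]. apply sub_length in Ht.
    rewrite length_pre in Ht. exact Ht. }
  { easy. }
  assert (Hlen : forall n, n <= length (p n)).
  { induction n as [|n IH]; [lia|].
    assert (length (p n) < length (p (S n))) by apply (Hp n). lia. }
  assert (Hext : forall m n, m <= n -> ext X m (p m) (p n)).
  { intros m n Hmn. induction Hmn as [|n Hmn IH]; [apply ext_refl|].
    apply ext_trans with (1 := IH). apply ext_le with n; [exact Hmn | apply (Hp n)]. }
  assert (Hon : forall n, on (p n) a).
  { assert (E : a = fun k => nth k (p (S k)) false).
    { apply functional_extensionality. intro n. unfold a, upper_bound.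
      destruct (nth_error_ex (p (S n)) n (Hlen (S n))) as [b Hb].
      rewrite (nth_error_nth _ _ false Hb).
      destruct (excluded_middle_informative _) as [[s [Hs Ht]]|Hn].
      - rewrite (least_run_functional _ _ _ _ _ _ Hs (proj1 (Hp (S n)))) in Ht. congruence.
      - destruct b; [|reflexivity]. exfalso. apply Hn. exists (p (S n)). split; [apply Hp | exact Hb]. }
    rewrite E. apply chain_limit; [|exact Hlen]. intro n. apply (Hp n). }
  assert (Ha : forall n, ext_real X n (p n) a).
  { intro n. split; [apply Hon|]. intros i j Hi Hl.
    pose (m := max n (S (pos i j))).
    destruct (nth_error_ex (p m) (pos i j)) as [b Hb].
    { specialize (Hlen m). lia. }
    rewrite (Hon m _ _ Hb). apply (Hext n m ltac:(lia)); auto. }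
  split.
  - intro i. apply turing_le_eventually with (K := length (p (S i))) (x := fun k => a (pos i k)).
    + intros k Hk. apply (Ha (S i)); [lia|]. pose proof (pos_ge i k). lia.
    + apply turing_le_column.
  - intros z [c Hc]. destruct (ec_onto c) as [n Hn].
    destruct (settles_sound G (ec n) X n (p (S n)) a z) as [i [_ Hi]].
    + apply (Hp n).
    + destruct (Ha (S n)) as [H1 H2]. split; [exact H1|]. intros i j Hi. apply H2. lia.
    + now rewrite Hn.
    + exists i. now apply G_inj.
Qed.

Lemma borel_upper_bound (X : nat -> cantor -> cantor) :
  (forall i, borel_fun (X i)) -> borel_fun (fun y => upper_bound (fun i => X i y)).
Proof.
  intro HX.
  assert (Hext : forall k s t, borel (fun y => ext (fun i => X i y) k s t)).
  { intros k s t. unfold ext. apply borel_and; [apply borel_const|].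
    do 3 (apply borel_all; [auto with enum|]; intro).
    do 3 (apply borel_imp; [apply borel_const|]). now apply borel_fun_eq_bit. }
  assert (Hset : forall e k s, borel (fun y => settles G e (fun i => X i y) k s)).
  (* The first clause of [settles] quantifies over reals but does not mention [X], so it is constant
     in [y]. *)
  { intros e k s. unfold settles. apply borel_or; [apply borel_const|]. apply borel_or.
    - apply borel_ex; [auto with enum|]. intro n.
      apply borel_all; [auto with enum|]. intro r.
      apply borel_imp; [apply Hext | apply borel_const].
    - apply borel_all; [auto with enum|]. intro r.
      apply borel_imp; [apply Hext|]. apply borel_ex; [auto with enum|]. intro i.
      apply borel_and; [apply borel_const|].
      do 2 (apply borel_all; [auto with enum|]; intro).
      apply borel_imp; [apply borel_const|]. now apply borel_fun_eq_bit. }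
  assert (Hst : forall n s t, borel (fun y => stage (fun i => X i y) n s t)).
  { intros n s t. unfold stage. apply borel_and; [apply Hext|].
    apply borel_and; [apply borel_const | apply Hset]. }
  assert (Hrun : forall n s, borel (fun y => least_run d (stage (fun i => X i y)) [] n s)).
  { induction n as [|n IH]; intro s; simpl; [apply borel_const|].
    do 2 (apply borel_ex; [auto with enum|]; intro).
    apply borel_and; [apply borel_const|]. apply borel_and; [apply IH|].
    apply borel_and; [apply Hst|]. apply borel_all; [auto with enum|]. intro c'.
    apply borel_imp; [apply borel_const | apply borel_not, Hst]. }
  apply borel_fun_asbool. intro n. apply borel_ex; [auto with enum|]. intro s.
  apply borel_and; [apply Hrun | apply borel_const].
Qed.

End Bounds.

(** [greedy] does not mention the perfect set, so the family, over all codes and starting strings,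
    is fixed first and [G] is then built independent of it. *)
Lemma borel_bounded_perfect_set :
  exists (G : cantor -> cantor) (ub : (nat -> cantor) -> cantor),
    borel_fun G /\
    (forall X : nat -> cantor -> cantor,
       (forall i, borel_fun (X i)) -> borel_fun (fun y => ub (fun i => X i y))) /\
    (forall (x : nat -> cantor) i, turing_le (G (x i)) (ub x)) /\
    (forall (x : nat -> cantor) z, turing_le (G z) (ub x) -> exists i, z = x i).
Proof.
  destruct (enumerable_list _ enumerable_bool) as [d Hd].
  destruct enumerable_code as [ec Hec].
  pose (F := fun j => greedy d (ec (fst (Cantor.of_nat j))) (d (snd (Cantor.of_nat j)))).
  destruct (independent_perfect_set F) as [G [G1 [G2 G3]]].
  { intros j l n v v'. apply greedy_functional. }
  { intros j l n v. apply greedy_continuous. }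
  assert (HG : borel_fun G).
  { intro n. apply (borel_local (S n)). intros x y Hxy H.
    rewrite <- (G1 x y (S n) Hxy n); [exact H | lia]. }
  assert (G4 : forall e q x l, ~ In x l -> ~ forall n, greedy d e q (map G l) n (G x n)).
  { intros e q x l Hx. destruct (Hec e) as [i <-], (Hd q) as [j <-].
    specialize (G3 (Cantor.to_nat (i, j)) x l Hx). unfold F in G3.
    now rewrite Cantor.cancel_of_to in G3. }
  pose proof (upper_bound_spec d Hd ec Hec G G1 G2 G4) as Hub.
  exists G, (fun x => upper_bound d ec G (fun i => G (x i))).
  split; [exact HG|]. split; [|split].
  - intros X HX. apply (borel_upper_bound d ec G (fun i y => G (X i y))).
    intro i. now apply borel_fun_comp.
  - intros x. apply Hub.
  - intros x. apply Hub.
Qed.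

(** * The Borel embedding of an order of height two *)

Theorem theorem1p6 (P : cantor -> Prop) (le : cantor * cantor -> Prop) :
  is_borel_partial_order P le ->
  locally_countable P le ->
  height_two le ->
  exists f : cantor -> cantor, borel_embedding_turing P le f.
Proof.
  intros [HP [Hle [Hdom [Hrefl [_ _]]]]] HC [_ Hht].
  destruct (lusin_novikov le Hle) as [g [Hg Hcov]].
  { intro y. destruct (classic (P y)) as [Py|Py].
    - destruct (HC y Py) as [e He].
      exists (fun n => match n with 0 => Some y | S n => e n end). intros x Hx.
      destruct (classic (x = y)) as [->|Hne]; [now exists 0|].
      destruct (He x (conj Hx Hne)) as [n Hn]. now exists (S n).
    - exists (fun _ => None). intros x Hx. exfalso. apply Py. now apply (Hdom x y). }
  destruct borel_bounded_perfect_set as [G [ub [HG [Hub [U1 U2]]]]].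
  (* For [y] in [P], this lists exactly the elements below [y]: [y] comes first and replaces each
     [g i y] that is not below [y]. *)
  pose (x := fun i y => match i with
    | 0 => y
    | S i => if excluded_middle_informative (le (g i y, y)) then g i y else y
    end).
  assert (Bx : forall i, borel_fun (x i)).
  { intros [|i]; [apply borel_fun_id|].
    apply (borel_fun_if (fun y => le (g i y, y))); [|apply Hg|apply borel_fun_id].
    apply borel2_preimage; [apply Hg | apply borel_fun_id | exact Hle]. }
  assert (Hx : forall y z, P y -> (le (z, y) <-> exists i, z = x i y)).
  { intros y z Py. split.
    - intro Hz. destruct (Hcov z y Hz) as [i ->]. exists (S i). simpl.
      now destruct (excluded_middle_informative _).
    - intros [[|i] ->]; simpl; [now apply Hrefl|].
      destruct (excluded_middle_informative _); [assumption | now apply Hrefl]. }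
  pose (minimal := fun y => forall i, x i y = y).
  pose (f := fun y => if excluded_middle_informative (minimal y) then G y
                      else ub (fun i => x i y)).
  assert (F1 : forall y i, turing_le (G (x i y)) (f y)).
  { intros y i. unfold f. destruct (excluded_middle_informative _) as [Hm|_].
    - rewrite Hm. apply turing_le_refl.
    - apply (U1 (fun i => x i y)). }
  assert (F2 : forall y z, turing_le (G z) (f y) -> exists i, z = x i y).
  (* As [y] is [x 0 y], the bound of all [x i y] computes [f y] even when [y] is minimal, so [U2]
     covers both cases. *)
  { intros y z Hz. apply (U2 (fun i => x i y)). apply turing_le_trans with (1 := Hz).
    unfold f. destruct (excluded_middle_informative _) as [_|_]; [|apply turing_le_refl].
    apply (U1 (fun i => x i y) 0). }
  exists f. split.
  - apply borel_measurable_of_borel_fun; [exact HP|].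
    apply (borel_fun_if minimal); [|exact HG | now apply Hub].
    apply borel_all; [auto with enum|]. intro i.
    apply (borel_eq_fun (x i) (fun y => y)); [apply Bx | apply borel_fun_id].
  - intros y z Py Pz. split.
    + intro Hyz. destruct (classic (y = z)) as [->|Hne]; [apply turing_le_refl|].
      (* A strict predecessor of [y] would complete a chain of three elements. *)
      assert (Hm : minimal y).
      { intro i. apply NNPP. intro Hi. apply Hht. exists (x i y), y, z.
        split; split; auto. apply Hx; eauto. }
      apply Hx in Hyz as [i ->]; [|exact Pz].
      unfold f at 1. destruct (excluded_middle_informative _) as [_|]; [|easy]. apply F1.
    (* As [y] is [x 0 y], [f y] computes [G y], and hence so does [f z]. *)
    + intro H. apply Hx; [exact Pz|]. apply F2. apply turing_le_trans with (2 := H).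
      apply (F1 y 0).
Qed.
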